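(* If the obstacle $\Psi$ is Lipschitz, then there exists a constant $C$, independent of $\epsilon\in(0,\gamma]$, such that the value $u^\epsilon$ of the $\epsilon$-obstacle tug-of-war game satisfies $$|u^\epsilon(x)-u^\epsilon(y)|\le C\,d_\epsilon(x,y)\qquad\text{for all }x,y\in\Omega\cup\Gamma,$$ where $d_\epsilon(x,y)=\epsilon\left[\frac{|x-y|}{\epsilon}+1\right]$ and $[\cdot]$ denotes the integer part.
   Context: Setting. $\Omega\subset\mathbb R^N$ is a bounded smooth domain, $\gamma>0$ is fixed, and $\Gamma=\{x\in\mathbb R^N\setminus\Omega:\operatorname{dist}(x,\partial\Omega)\le\gamma\}$. The final payoff $F:\Gamma\to\mathbb R$ is Lipschitz, and the obstacle is a function $\Psi:\mathbb R^N\to\mathbb R$ with $\Psi\le F$ in $\Gamma$. $B_\epsilon(x)$ is the ball of radius $\epsilon$ centered at $x$. The $\epsilon$-obstacle tug-of-war game ($0<\epsilon\le\gamma$). A token starts at $x_0$. If $x_0\in\Gamma$ the game ends at once. At each stage $k$ with $x_k\in\Omega$, Player I may end the game; otherwise each player $i\in\{I,II\}$ chooses an action $a_k^i\in B_\epsilon(x_k)$, a fair coin is tossed, and $x_{k+1}=a_k^I$ or $x_{k+1}=a_k^{II}$ with probability $1/2$ each. The game also ends when the token reaches $\Gamma$. When the game ends at position $x_\tau$, Player II pays Player I the amount $\tilde F(x_\tau)$, where $\tilde F=F$ on $\Gamma$ and $\tilde F=\Psi$ on $\Omega$. A strategy $S_i$ of Player $i$ is a sequence of Borel-measurable maps sending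 each history $(x_0,a_0,x_1,\dots,a_{k-1},x_k)$ (where $a_j=(a_j^I,a_j^{II})$) to a point of $B_\epsilon(x_k)$. A stopping rule $\tau$ for Player I is a finite, Borel-measurable stopping time with values in $\mathbb N=\{0,1,2,\dots\}$ with respect to the histories ($\tau=k$ means that Player I ends the game at stage $k$, if it has not ended already). These data induce a probability on plays with expectation $\mathbb E^{x_0}_{\tau,S_I,S_{II}}$. Let $V_{x_0,I}(\tau,S_I,S_{II})=V_{x_0,II}(\tau,S_I,S_{II})=\mathbb E^{x_0}_{\tau,S_I,S_{II}}[\tilde F(x_\tau)]$ ($x_\tau$ the terminal position) if the game terminates almost surely, and otherwise $V_{x_0,I}=-\infty$, $V_{x_0,II}=+\infty$. The values for the two players are $$u_I^\epsilon(x_0)=\sup_{\tau,S_I}\inf_{S_{II}}V_{x_0,I}(\tau,S_I,S_{II}),\qquad u_{II}^\epsilon(x_0)=\inf_{S_{II}}\sup_{\tau,S_I}V_{x_0,II}(\tau,S_I,S_{II}),$$ and the value of the game is the common function $u^\epsilon=u_I^\epsilon=u_{II}^\epsilon$ on $\Omega\cup\Gamma$ (the two coincide). *)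

(* Defs.v *)
From HB Require Import structures.
From mathcomp Require Import all_boot all_order all_algebra.
From mathcomp Require Import all_classical all_reals all_analysis.
From mathcomp Require Import zify ring lra.

Set Implicit Arguments.
Unset Strict Implicit.
Unset Printing Implicit Defensive.

Import Order.TTheory GRing.Theory Num.Theory.
Import numFieldNormedType.Exports.

Local Open Scope classical_set_scope.
Local Open Scope ring_scope.

(* The library norm on 'rV[R]_N is the sup norm, hence the explicit Euclidean
   one; both induce the same topology and the same bounded sets. *)
Definition enorm {R : realType} {N : nat} (v : 'rV[R]_N) : R :=
  Num.sqrt (\sum_(i < N) v ord0 i ^+ 2).

Definition eball {R : realType} {N : nat} (x : 'rV[R]_N) (r : R) :
  set 'rV[R]_N := [set y | enorm (y - x) < r].

Definition elipschitz {R : realType} {N : nat} (A : set 'rV[R]_N)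
    (f : 'rV[R]_N -> R) : Prop :=
  exists L : R, forall x y, A x -> A y -> `|f x - f y| <= L * enorm (x - y).

Definition boundary {T : topologicalType} (A : set T) : set T :=
  closure A `\` interior A.

Definition edist_to {R : realType} {N : nat} (x : 'rV[R]_N)
    (A : set 'rV[R]_N) : R := inf [set enorm (x - y) | y in A].

Definition partial {R : realType} {N : nat} (i : 'I_N) (f : 'rV[R]_N -> R) :
  'rV[R]_N -> R := fun x => 'D_('e_i) f x.

Fixpoint class_C {R : realType} {N : nat} (n : nat) (U : set 'rV[R]_N)
    (f : 'rV[R]_N -> R) : Prop :=
  (forall x, U x -> {for x, continuous f}) /\
  if n is m.+1 then
    forall i : 'I_N, (forall x, U x -> derivable f x 'e_i) /\
                     class_C m U (partial i f)
  else True.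

(* C^oo boundary: near each boundary point, Omega is the negative side of a
   C^oo function whose gradient does not vanish at that point. *)
Definition smooth_boundary {R : realType} {N : nat} (Omega : set 'rV[R]_N) :
    Prop :=
  forall p, boundary Omega p ->
  exists (U : set 'rV[R]_N) (phi : 'rV[R]_N -> R),
    [/\ open U, U p, (forall n, class_C n U phi),
        (exists i, partial i phi p != 0) &
        forall x, U x -> (Omega x <-> phi x < 0)].

Definition bounded_smooth_domain {R : realType} {N : nat}
    (Omega : set 'rV[R]_N) : Prop :=
  [/\ open Omega, connected Omega, Omega !=set0, bounded_set Omega &
      smooth_boundary Omega].

Definition boundary_strip {R : realType} {N : nat} (Omega : set 'rV[R]_N)
    (gamma : R) : set 'rV[R]_N :=
  [set x | ~ Omega x /\ edist_to x (boundary Omega) <= gamma].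

Definition d_eps {R : realType} {N : nat} (eps : R) (x y : 'rV[R]_N) : R :=
  eps * (Num.floor (enorm (x - y) / eps + 1))%:~R.

Definition open_sets (R : realType) (N : nat) : set (set 'rV[R]_N) :=
  [set A | open A].

(* R^N with its Borel sigma-algebra; the carrier is 'rV[R]_N itself. *)
Notation point R N := (g_sigma_algebraType (@open_sets R N)).

(* What happens at stage k : the position x_k and the pair of actions
   a_k = (a_k^I, a_k^II). *)
Notation stage R N := (point R N * (point R N * point R N))%type.

(* A history (x_0, a_0, ..., x_{k-1}, a_{k-1}, x_k) : the first k stages,
   followed by the current position. *)
Notation history R N k := (k.-tuple (stage R N) * point R N)%type.

Definition play (R : realType) (N : nat) : Type := nat -> stage R N.

Definition history_of {R : realType} {N : nat} (w : play R N) (k : nat) :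
  history R N k := ([tuple w i | i < k], (w k).1).

Record strategy (R : realType) (N : nat) (eps : R) := Strategy {
  action :> forall k, history R N k -> point R N;
  action_measurable : forall k, measurable_fun setT (@action k);
  action_ball : forall k (h : history R N k), eball h.2 eps (@action k h)
}.

Record stopping_rule (R : realType) (N : nat) := StoppingRule {
  stop_time :> play R N -> nat;
  stop_time_adapted : forall k, exists2 A : set (history R N k),
    measurable A & forall w, stop_time w = k <-> A (history_of w k)
}.

(* The fair coin tosses are realized as the binary digits of a uniform random
   number in [0, 1]; [coin_fair] below states that they are independent and
   fair. *)
Definition coin_prob (R : realType) : probability (measurableTypeR R) R :=
  uniform_prob (@ltr01 R).

Definition coin {R : realType} (omega : R) (k : nat) : bool :=
  odd (Num.truncn (2 ^+ k.+1 * omega)).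

Lemma truncn_geP {R : realType} (x : R) (m : nat) : (0 < m)%N ->
  (Num.truncn x == m) = (m%:R <= x < m.+1%:R).
Proof.
move=> m0; have [x0|x0] := leP 0 x; first exact: truncn_eq.
rewrite truncn_floor leNgt x0 /= eq_sym (gtn_eqF m0).
by apply/esym/negbTE; rewrite negb_and -ltNge (lt_le_trans x0).
Qed.

Lemma measurable_coin {R : realType} (k : nat) :
  measurable_fun setT (fun omega : measurableTypeR R => coin omega k).
Proof.
apply: (measurable_fun_bool true); rewrite setTI.
rewrite (_ : _ @^-1` _ = \bigcup_(m in [set m : nat | odd m])
   `[m%:R / 2 ^+ k.+1, m.+1%:R / 2 ^+ k.+1[%classic).
  by apply: bigcup_measurable => m _; exact: measurable_itv.
have p0 : 0 < (2 ^+ k.+1 : R) by rewrite exprn_gt0.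
have E (m : nat) (x : R) : odd m ->
    (x \in `[m%:R / 2 ^+ k.+1, m.+1%:R / 2 ^+ k.+1[) =
    (Num.truncn (2 ^+ k.+1 * x) == m).
  move=> om; rewrite truncn_geP ?odd_gt0// in_itv /=.
  by rewrite ler_pdivrMr// ltr_pdivlMr// mulrC.
apply/seteqP; split => [x /= cx|x [m /= om]].
  by exists (Num.truncn (2 ^+ k.+1 * x)) => //=; rewrite E.
by rewrite E// => /eqP mE; rewrite /coin mE.
Qed.

Definition dyadic (b : nat -> bool) : nat -> nat :=
  fix dyadic n := if n is m.+1 then (b m + (dyadic m).*2)%N else 0%N.

Lemma dyadic_lt b n : (dyadic b n < 2 ^ n)%N.
Proof. by elim: n => //= n IH; rewrite expnS -muln2; move: IH; case: (b n) => /=; move: (expn _ _) (dyadic _ _) => p d; lia. Qed.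

Lemma truncn_half {R : realType} (x : R) : 0 <= x ->
  Num.truncn x = (Num.truncn (2 * x))./2.
Proof.
move=> x0; apply/eqP; rewrite truncn_eq//.
have /andP[] : (Num.truncn (2 * x))%:R <= 2 * x < (Num.truncn (2 * x)).+1%:R.
  by apply: truncn_itv; rewrite mulr_ge0.
move: (Num.truncn _) => t; move: (odd_double_half t).
move: (t./2) (odd t) => s o <-.
rewrite -[(_ + _).+1]addn1 -[s.+1]addn1 -muln2 !natrD natrM.
by case: o; move: (s%:R : R) => r /= l u; rewrite ?mulr0n ?mulr1n in l u *; apply/andP; split; lra.
Qed.

Lemma coin_dyadic {R : realType} (b : nat -> bool) (n : nat) (x : R) :
  0 <= x < 1 ->
  (forall k, (k < n)%N -> coin x k = b k) <->
  Num.truncn (2 ^+ n * x) = dyadic b n.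
Proof.
move=> /andP[x0 x1]; elim: n => [|n IH] /=.
  split=> // _; rewrite expr0 mul1r; apply: truncn_def.
  by rewrite x0 x1.
have p0 : 0 <= 2 ^+ n * x by rewrite mulr_ge0// exprn_ge0.
have H := truncn_half p0; rewrite mulrA -exprS in H.
have T := odd_double_half (Num.truncn (2 ^+ n.+1 * x)).
split=> [cb|E].
  rewrite -T -H (IH.1 _) => [|k kn]; last by rewrite cb// ltnS ltnW.
  by rewrite -[odd _]/(coin x n) cb.
have E1 : Num.truncn (2 ^+ n * x) = dyadic b n.
  by rewrite H E halfD /= odd_double doubleK; case: (b n).
move=> k; rewrite ltnS leq_eqVlt => /orP[/eqP ->|]; last exact: IH.2.
by rewrite /coin E oddD odd_double addbF; case: (b n).
Qed.

Lemma measurable_coins {R : realType} (b : nat -> bool) (n : nat) :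
  measurable [set omega : measurableTypeR R |
    forall k, (k < n)%N -> coin omega k = b k].
Proof.
rewrite (_ : mkset _ = \bigcap_(k in [set k | (k < n)%N])
  ((fun omega : measurableTypeR R => coin omega k) @^-1` [set b k])).
  apply: bigcap_measurableType => k _.
  by rewrite -[X in measurable X]setTI; exact: measurable_coin.
by apply/seteqP; split.
Qed.

Lemma coin_fair {R : realType} (b : nat -> bool) (n : nat) :
  coin_prob R [set omega | forall k, (k < n)%N -> coin omega k = b k] =
  (2^-1 ^+ n)%:E.
Proof.
set S := [set omega | _].
have mS : measurable (S : set (measurableTypeR R)) by exact: measurable_coins.
rewrite /coin_prob /= /uniform_prob integral_uniform_pdf.
rewrite (eq_integral (fun=> 1%:E)); last first.
  move=> x; rewrite inE => -[_] /=; rewrite in_itv /= /uniform_pdf => ->.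
  by rewrite subr0 invr1.
have mI : measurable (S `&` `[0, 1]%classic : set (measurableTypeR R)).
  by apply: measurableI => //; exact: measurable_itv.
rewrite integral_cst// mul1e.
have p0 : 0 < (2 ^+ n : R) by rewrite exprn_gt0.
set I := `[(dyadic b n)%:R / 2 ^+ n, (dyadic b n).+1%:R / 2 ^+ n[%classic : set R.
have IE x : 0 <= x -> I x <-> Num.truncn (2 ^+ n * x) = dyadic b n.
  move=> x0; rewrite /I /= in_itv /= ler_pdivrMr// ltr_pdivlMr// mulrC.
  rewrite -truncn_eq; last by rewrite mulr_ge0// ltW.
  by split=> /eqP.
have I01 x : I x -> 0 <= x < 1.
  rewrite /I /= in_itv /= => /andP[l r]; apply/andP; split.
    by apply: le_trans l; rewrite divr_ge0// ltW.
  apply: lt_le_trans r _; rewrite ler_pdivrMr// mul1r -natrX ler_nat.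
  exact: dyadic_lt.
transitivity (lebesgue_measure I).
  rewrite (_ : S `&` _ = I `|` (S `&` [set 1])); last first.
    apply/seteqP; split=> x.
      move=> [Sx] /=; rewrite in_itv /= => /andP[x0].
      rewrite le_eqVlt => /orP[/eqP x1|x1]; first by right.
      by left; apply/IE => //; apply/coin_dyadic; rewrite ?x0.
    case=> [Ix|[Sx /= x1]]; last first.
      by split=> //=; rewrite x1 in_itv /= ler01 lexx.
    have /andP[x0 x1] := I01 _ Ix; split.
      by apply/coin_dyadic; rewrite ?x0//; apply/IE.
    by rewrite /= in_itv /= x0 ltW.
  have m1 : measurable (S `&` [set 1] : set (measurableTypeR R)).
    by apply: measurableI => //; exact: measurable_set1.
  apply: measureU0 => //; first exact: measurable_itv.
  apply/eqP; rewrite eq_le measure_ge0 andbT.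
  rewrite -[leRHS](lebesgue_measure_set1 (1 : R)).
  by apply: le_measure; rewrite ?inE//; exact: measurable_set1.
rewrite /I lebesgue_measure_itv /= lte_fin ltr_pM2r ?invr_gt0// ltr_nat ltnSn.
by rewrite -EFinB -mulrBl -natrB// subSnn mul1r exprVn.
Qed.

Fixpoint run_history {R : realType} {N : nat} {eps : R}
    (SI SII : strategy N eps) (x0 : 'rV[R]_N) (c : nat -> bool) (k : nat) :
    history R N k :=
  if k is j.+1 then
    let h := run_history SI SII x0 c j in
    let a := (SI j h, SII j h) in
    (rcons_tuple h.1 (h.2, a), if c j then a.1 else a.2)
  else ([tuple], x0).

(* The play induced by the strategies and the coin tosses (player I wins the
   k-th toss iff [c k]).  It is continued after the end of the game, which is
   harmless: only the terminal position below is used. *)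
Definition run {R : realType} {N : nat} {eps : R} (SI SII : strategy N eps)
    (x0 : 'rV[R]_N) (c : nat -> bool) : play R N := fun k =>
  let h := run_history SI SII x0 c k in (h.2, (SI k h, SII k h)).

Section Game.
Context {R : realType} {N : nat}.
Context (Omega : set 'rV[R]_N) (gamma : R) (F Psi : 'rV[R]_N -> R) (eps : R).

Let Gamma := boundary_strip Omega gamma.

Definition payoff (x : 'rV[R]_N) : R := if x \in Gamma then F x else Psi x.

Definition terminates (tau : stopping_rule R N) (w : play R N) : Prop :=
  exists k, Gamma (w k).1 \/ tau w = k.

(* The least k such that x_k is in Gamma or k = tau. *)
Definition terminal_stage (tau : stopping_rule R N) (w : play R N) : nat :=
  find (fun k => ((w k).1 : 'rV[R]_N) \in Gamma) (iota 0 (tau w)).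

Definition terminal_position (tau : stopping_rule R N) (w : play R N) :
  'rV[R]_N := (w (terminal_stage tau w)).1.

Definition terminates_as (x0 : 'rV[R]_N) (tau : stopping_rule R N)
    (SI SII : strategy N eps) : Prop :=
  {ae coin_prob R, forall omega, terminates tau (run SI SII x0 (coin omega))}.

Definition expected_payoff (x0 : 'rV[R]_N) (tau : stopping_rule R N)
    (SI SII : strategy N eps) : \bar R :=
  'E_(coin_prob R)[fun omega =>
     payoff (terminal_position tau (run SI SII x0 (coin omega)))]%E.

Definition V_I x0 tau SI SII : \bar R :=
  if `[< terminates_as x0 tau SI SII >] then expected_payoff x0 tau SI SII
  else -oo%E.

Definition V_II x0 tau SI SII : \bar R :=
  if `[< terminates_as x0 tau SI SII >] then expected_payoff x0 tau SI SII
  else +oo%E.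

Definition u_I (x0 : 'rV[R]_N) : \bar R :=
  ereal_sup [set ereal_inf [set V_I x0 tau SI SII | SII in [set: strategy N eps]]
            | tau in [set: stopping_rule R N] & SI in [set: strategy N eps]].

Definition u_II (x0 : 'rV[R]_N) : \bar R :=
  ereal_inf [set ereal_sup [set V_II x0 tau SI SII
               | tau in [set: stopping_rule R N] & SI in [set: strategy N eps]]
            | SII in [set: strategy N eps]].

End Game.

(* Main.v *)
Require Import Defs.
From mathcomp Require Import all_boot all_order all_algebra.
From mathcomp Require Import all_classical all_reals all_analysis.
From mathcomp Require Import measurable_realfun zify ring lra.
Require Import Defs.

(** A stopping rule takes a finite value on every play, so the game always
    terminates and both payoffs V_I and V_II equal the expected payoff.  For
    fixed strategies a play is governed by the coin tosses alone, and its
    possible histories form a binary tree.  As the rule stops on every infinite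
    branch, the tree is well-founded, and the expected payoff is computed by
    averaging over the two children of each node: this is the inductive
    relation [value], which exists by bar induction ([value_exists]) and is the
    expectation ([expected_payoff_value]).  From there on, only finite
    averages along this tree matter, and supermartingale arguments become
    inductions on [value] ([value_le], [value_ge]).

    The estimate itself is a comparison with cones.  Let [steps eps y x] be 0 at
    x = y and the integer part of |x - y| / eps, plus 1, elsewhere.  A player who
    always moves towards y ([pull]) lowers it by at least 1 when winning the
    toss, and the opponent raises it by at most 1 otherwise; so, until y is
    reached, it is a supermartingale.  Suppose that a player has a strategy for
    the game started at y that guarantees B.  From x that player pulls the token
    to y and then continues as if the game started there
    ([pull_then_strategy]).  If terminal payoffs at z are within
    L * eps * steps eps y z of B on the favourable side, this guarantees B up to
    L * eps * steps eps y x, which is at most L * d_eps x y.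

    For player II this is [uII_le_pull_then].  Player I must moreover choose a
    finite stopping rule, hence gives up pulling after n stages
    ([deadline_rule]); a strictly concave correction of the cone, available
    because Omega is bounded, shows that the loss is O(1/n)
    ([uI_ge_pull_then]).

    With y in the boundary strip the token cannot move any further, so B = F y:
    this bounds both values between cones with vertices in the strip, since
    u_I <= u_II.  These bounds, together with u_I >= Psi, show that
    terminal payoffs satisfy the hypothesis above for every y, with B arbitrarily
    close to the value at y, and a second application of the two lemmas gives
    the Lipschitz bound, with L the sum of the Lipschitz constants of F and Psi. *)

Set Implicit Arguments.
Unset Strict Implicit.
Unset Printing Implicit Defensive.

Import Order.TTheory GRing.Theory Num.Theory.
Import numFieldNormedType.Exports.

Local Open Scope classical_set_scope.
Local Open Scope ring_scope.

(** * Euclidean norm and boundary crossing *)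

Section Euclidean.
Context {R : realType} {N : nat}.
Implicit Types u v x y z : 'rV[R]_N.

Lemma enorm_ge0 v : 0 <= enorm v.
Proof. exact: sqrtr_ge0. Qed.

Lemma sqr_enorm v : enorm v ^+ 2 = \sum_(i < N) v ord0 i ^+ 2.
Proof. by rewrite sqr_sqrtr// sumr_ge0// => i _; exact: sqr_ge0. Qed.

Lemma enorm0 : enorm (0 : 'rV[R]_N) = 0.
Proof.
by rewrite /enorm big1 ?sqrtr0// => i _; rewrite mxE expr0n.
Qed.

Lemma enorm_eq0 v : enorm v = 0 -> v = 0.
Proof.
move=> v0; have /eqP := sqr_enorm v; rewrite v0 expr0n /= eq_sym.
rewrite psumr_eq0; last by move=> i _; exact: sqr_ge0.
move=> /allP H; apply/rowP => i; rewrite mxE; apply/eqP.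
by rewrite -sqrf_eq0; apply: H; rewrite mem_index_enum.
Qed.

Lemma enormZ (c : R) v : enorm (c *: v) = `|c| * enorm v.
Proof.
rewrite /enorm -sqrtr_sqr -sqrtrM ?sqr_ge0// mulr_sumr; congr Num.sqrt.
by apply: eq_bigr => i _; rewrite mxE exprMn.
Qed.

Lemma enormN v : enorm (- v) = enorm v.
Proof. by rewrite -scaleN1r enormZ normrN1 mul1r. Qed.

Lemma enormB x y : enorm (x - y) = enorm (y - x).
Proof. by rewrite -enormN opprB. Qed.

Lemma dot_le_enorm u v :
  \sum_(i < N) u ord0 i * v ord0 i <= enorm u * enorm v.
Proof.
have [u0|u0] := eqVneq (enorm u) 0.
  rewrite u0 mul0r (enorm_eq0 u0) big1// => i _.
  by rewrite mxE mul0r.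
have [v0|v0] := eqVneq (enorm v) 0.
  rewrite v0 mulr0 (enorm_eq0 v0) big1// => i _.
  by rewrite mxE mulr0.
have up : 0 < enorm u by rewrite lt0r u0 enorm_ge0.
have vp : 0 < enorm v by rewrite lt0r v0 enorm_ge0.
set a := enorm u; set b := enorm v.
have : 0 <= \sum_(i < N) (b * u ord0 i - a * v ord0 i) ^+ 2.
  by apply: sumr_ge0 => i _; exact: sqr_ge0.
have -> : \sum_(i < N) (b * u ord0 i - a * v ord0 i) ^+ 2 =
    2 * (a * b) * (a * b - \sum_(i < N) u ord0 i * v ord0 i).
  transitivity (b ^+ 2 * (\sum_(i < N) u ord0 i ^+ 2) +
      a ^+ 2 * (\sum_(i < N) v ord0 i ^+ 2) -
      2 * (a * b) * \sum_(i < N) u ord0 i * v ord0 i).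
    rewrite !mulr_sumr -!big_split/= -sumrB.
    by apply: eq_bigr => i _; ring.
  by rewrite -!sqr_enorm -/a -/b; ring.
by rewrite pmulr_rge0 ?subr_ge0// mulr_gt0// mulr_gt0.
Qed.

Lemma enormD u v : enorm (u + v) <= enorm u + enorm v.
Proof.
rewrite -(@ler_pXn2r _ 2)// ?nnegrE ?addr_ge0 ?enorm_ge0//.
rewrite sqrrD !sqr_enorm.
have -> : \sum_(i < N) (u + v) ord0 i ^+ 2 = \sum_(i < N) u ord0 i ^+ 2 +
    (\sum_(i < N) u ord0 i * v ord0 i) *+ 2 + \sum_(i < N) v ord0 i ^+ 2.
  rewrite -sumrMnl -!big_split/=; apply: eq_bigr => i _.
  by rewrite mxE sqrrD.
by rewrite lerD2r lerD2l lerMn2r /= dot_le_enorm.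
Qed.

Lemma enorm_triangle z x y : enorm (x - y) <= enorm (x - z) + enorm (z - y).
Proof. by rewrite (le_trans _ (enormD _ _))// addrA subrK. Qed.

Lemma continuous_enormB y : continuous (fun z : 'rV[R]_N => enorm (z - y)).
Proof.
have sumc : continuous (fun v : 'rV[R]_N => \sum_(i < N) (v - y) ord0 i ^+ 2).
  apply: continuous_big => [|i _ v]; first exact: add_continuous.
  rewrite [X in continuous_at _ X](_ : _ =
    (fun t => (t - y ord0 i) ^+ 2) \o (fun w : 'rV[R]_N => w ord0 i)); last first.
    by apply/funext => w /=; rewrite !mxE.
  apply: continuous_comp; first exact: coord_continuous.
  apply: (@continuous_comp _ _ _ (fun t : R => t - y ord0 i) (fun t => t ^+ 2)).
    by apply: cvgB; [exact: cvg_id|exact: cvg_cst].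
  exact: exprn_continuous.
move=> x; apply: (@continuous_comp _ _ _ _ Num.sqrt); first exact: sumc.
exact: sqrt_continuous.
Qed.

Lemma open_eball y (r : R) : open [set z : 'rV[R]_N | enorm (z - y) < r].
Proof.
by apply: (open_comp (f := fun z : 'rV[R]_N => enorm (z - y))
  (D := [set t : R | t < r])) => [z _|]; [exact: continuous_enormB|exact: open_lt].
Qed.

Lemma bounded_enorm (A : set 'rV[R]_N) : bounded_set A ->
  exists M, forall x, A x -> enorm x <= M.
Proof.
move=> [M [_ MA]]; exists (Num.sqrt (\sum_(i < N) (`|M| + 1) ^+ 2)) => x Ax.
have xM : `|x| <= `|M| + 1 by apply: MA => //; rewrite ltr_pwDr// ler_norm.
apply: ler_wsqrtr; apply: ler_sum => i _.
rewrite -real_normK ?num_real// lerXn2r ?nnegrE// ?addr_ge0//.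
apply: le_trans xM; rewrite [leRHS]/Num.Def.normr/= mx_normrE.
exact: (le_bigmax _ (fun ij : 'I_1 * 'I_N => `|x ij.1 ij.2|) (ord0, i)).
Qed.

(** If the segment from z to x missed the boundary, its trace in Omega would be
    both open and closed in it, hence all of it by connectedness. *)
Lemma edist_to_boundary_le (Omega : set 'rV[R]_N) z x :
  open Omega -> Omega z -> ~ Omega x ->
  exists2 w, boundary Omega w & enorm (x - w) <= enorm (x - z).
Proof.
move=> oO Oz nOx; pose f (t : R) := z + t *: (x - z).
have fc : continuous f.
  by move=> t; apply: cvgD; [exact: cvg_cst|apply: cvgZr_tmp; exact: cvg_id].
apply: contrapT => nw.
have nb t : t \in `[0, 1] -> ~ boundary Omega (f t).
  rewrite in_itv/= => /andP[t0 t1] bt; apply: nw; exists (f t) => //.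
  have -> : x - f t = (1 - t) *: (x - z).
    by rewrite /f opprD addrA scalerBl scale1r.
  rewrite enormZ ger0_norm ?subr_ge0// ler_piMl ?enorm_ge0//.
  by rewrite lerBlDr lerDl.
have cS : connected (f @` `[0, 1]).
  apply: connected_continuous_connected; first exact: segment_connected.
  exact: continuous_subspaceT.
have E : (f @` `[0, 1]) `&` Omega = f @` `[0, 1].
  apply: cS.
  - by exists z; split=> //; exists 0; rewrite /= ?in_itv/= ?lexx ?ler01// /f scale0r addr0.
  - by exists Omega.
  - exists (closure Omega); first exact: closed_closure.
    apply/seteqP; split=> _ [[t tI <-]] Ot; split; try by exists t.
      exact: subset_closure.
    apply: contrapT => nO; apply: (nb t) => //; split=> //.
    by rewrite ((interior_id Omega).1 oO).
apply: nOx; suff [] : ((f @` `[0, 1]) `&` Omega) x by [].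
rewrite E; exists 1; first by rewrite /= in_itv/= lexx ler01.
by rewrite /f scale1r addrC subrK.
Qed.

Lemma edist_to_le (A : set 'rV[R]_N) x w : A w -> edist_to x A <= enorm (x - w).
Proof.
move=> Aw; apply: ge_inf; last by exists w.
by exists 0 => _ [v _ <-]; exact: enorm_ge0.
Qed.

End Euclidean.

(** * Pulling the token towards a target *)

Section Steps.
Context {R : realType} {N : nat} (eps : R) (y : 'rV[R]_N).
Hypothesis eps_gt0 : 0 < eps.
Implicit Types x z : 'rV[R]_N.

Definition annulus z : nat := Num.truncn (enorm (z - y) / eps).

(** The distance d_eps to y in units of eps, except that it vanishes at y itself:
    it counts the moves that bring an unopposed token from z to y. *)
Definition steps z : nat := if z == y then 0%N else (annulus z).+1.

Definition scale_to (m : nat) z : 'rV[R]_N := y + (m%:R / m.+1%:R) *: (z - y).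

(** A move has to be shorter than eps and yet to reach the next annulus.  The
    homothety of ratio m / (m + 1) does both: a point at distance r from y, with
    m * eps <= r < (m + 1) * eps, moves by r / (m + 1) < eps to the distance
    m * r / (m + 1) < m * eps.  For m = 0 it lands on y. *)
Definition pull z : 'rV[R]_N := scale_to (annulus z) z.

Lemma annulus_le z m : (annulus z <= m)%N = (enorm (z - y) < eps * m.+1%:R).
Proof. by rewrite truncn_le_nat ltr_pdivrMr// mulrC. Qed.

Lemma lt_annulusS z : enorm (z - y) < eps * (annulus z).+1%:R.
Proof. by rewrite -annulus_le. Qed.

Lemma steps_id : steps y = 0%N.
Proof. by rewrite /steps eqxx. Qed.

Lemma steps_gt0 z : z != y -> steps z = (annulus z).+1.
Proof. by rewrite /steps => /negbTE ->. Qed.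

Lemma enorm_le_steps z : enorm (z - y) <= eps * (steps z)%:R.
Proof.
have [->|zy] := eqVneq z y; first by rewrite steps_id subrr enorm0 mulr0.
by rewrite steps_gt0// ltW// lt_annulusS.
Qed.

Lemma steps_le_d_eps z : eps * (steps z)%:R <= d_eps eps z y.
Proof.
rewrite /d_eps ler_pM2l//.
have -> : Num.floor (enorm (z - y) / eps + 1) = (annulus z).+1%:Z.
  rewrite /annulus; set r := enorm (z - y) / eps.
  have r0 : 0 <= r by rewrite divr_ge0 ?enorm_ge0// ltW.
  rewrite truncn_floor r0 floorDrz ?rpred1// floor1 intS addrC.
  by rewrite gez0_abs// floor_ge0.
by rewrite -pmulrn ler_nat /steps; case: ifP.
Qed.

Lemma pull_dist z : enorm (pull z - z) < eps.
Proof.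
rewrite /pull /scale_to.
set m := annulus z.
have m0 : 0 < m.+1%:R :> R by rewrite ltr0n.
have -> : y + (m%:R / m.+1%:R) *: (z - y) - z = - ((m.+1%:R)^-1 *: (z - y)).
  apply/rowP => i; rewrite !mxE; move: (y ord0 i) (z ord0 i) => a b.
  rewrite -[m.+1]addn1 natrD in m0 *; field.
  by rewrite gt_eqF.
rewrite enormN enormZ gtr0_norm ?invr_gt0// mulrC ltr_pdivrMr//.
exact: lt_annulusS.
Qed.

Lemma steps_pull z : z != y -> ((steps (pull z)).+1 <= steps z)%N.
Proof.
move=> zy; rewrite (steps_gt0 zy) ltnS.
have E : enorm (pull z - y) =
    ((annulus z)%:R / (annulus z).+1%:R) * enorm (z - y).
  by rewrite /pull /scale_to addrC addKr enormZ ger0_norm.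
have [p|py] := eqVneq (pull z) y; first by rewrite p steps_id.
rewrite (steps_gt0 py).
case A : (annulus z) => [|m].
  exfalso; move/eqP: py; apply; rewrite -[LHS](subrK y).
  by rewrite (enorm_eq0 (v := pull z - y)) ?add0r// E A mul0r mul0r.
rewrite ltnS annulus_le E A.
have := lt_annulusS z; rewrite A => H.
by rewrite (mulrC eps) -mulrA ltr_pM2l ?ltr0n// mulrC ltr_pdivrMr// ltr0n.
Qed.

Lemma steps_move z z' : z != y -> enorm (z' - z) < eps ->
  (steps z' <= (steps z).+1)%N.
Proof.
move=> zy zz'; rewrite (steps_gt0 zy) /steps; case: ifP => // _.
rewrite ltnS annulus_le (le_lt_trans (enorm_triangle z _ _))//.
rewrite -[(annulus z).+2]addn1 natrD mulrDr mulr1 addrC ltrD//.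
exact: lt_annulusS.
Qed.

End Steps.

(** * The tree of histories and its values *)

Section GameTree.
Context {R : realType} {N : nat}.

(** Histories of any length.  The length is not part of the type, so that
    histories can be concatenated and cut without casts. *)
Definition node : Type := (seq (stage R N) * point R N)%type.

Definition start (x : 'rV[R]_N) : node := ([::], x).

Section Value.
Context (P : 'rV[R]_N -> R) (stop : node -> Prop) (aI aII : node -> point R N).

Definition child (h : node) (b : bool) : node :=
  (rcons h.1 (h.2, (aI h, aII h)), if b then aI h else aII h).

(** The expected payoff of the remaining game, as a well-founded average over the
    coin tosses: each branch of the tree of histories stops after finitely many
    stages, although there need not be a bound that works for all strategies. *)
Inductive value : node -> R -> Prop :=
| value_stop h : stop h -> value h (P h.2)
| value_step h v1 v2 : ~ stop h ->
    value (child h true) v1 -> value (child h false) v2 ->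
    value h ((v1 + v2) / 2).

Fixpoint branch (h : node) (c : nat -> bool) (k : nat) : node :=
  if k is j.+1 then child (branch h c j) (c j) else h.

Lemma size_branch h c k : size (branch h c k).1 = (size h.1 + k)%N.
Proof. by elim: k => [|k IH] /=; rewrite ?addn0// size_rcons IH addnS. Qed.

Lemma eq_branch h c c' k : (forall i, (i < k)%N -> c i = c' i) ->
  branch h c k = branch h c' k.
Proof.
elim: k => //= k IH cc'; rewrite IH => [|i ik]; last by rewrite cc'// ltnW.
by rewrite cc'.
Qed.

Lemma nth_branch d d' h c k k' i : (i < size h.1 + k)%N -> (k <= k')%N ->
  nth d (branch h c k').1 i = nth d' (branch h c k).1 i.
Proof.
move=> ik /subnKC <-; elim: (k' - k)%N => [|n IH].
  by rewrite addn0; apply: set_nth_default; rewrite size_branch.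
rewrite addnS /= nth_rcons size_branch -IH.
by rewrite (leq_trans ik)// leq_add2l leq_addr.
Qed.

Definition branch_play (h : node) (c : nat -> bool) : play R N :=
  fun i => nth (h.2, (h.2, h.2)) (branch h c i.+1).1 i.

Lemma branch_play_start x c k :
  branch_play (start x) c k =
  let h := branch (start x) c k in (h.2, (aI h, aII h)).
Proof. by rewrite /branch_play /= nth_rcons size_branch ltnn eqxx. Qed.

End Value.

(** That w and w' have the same history at stage k, stated without tuples. *)
Definition agree (k : nat) (w w' : play R N) : Prop :=
  (forall i, (i < k)%N -> w i = w' i) /\ (w k).1 = (w' k).1.

Lemma agreeS k w w' : agree k w w' -> forall j, (j <= k)%N -> agree j w w'.
Proof.
move=> [ww' wk] j; rewrite leq_eqVlt => /orP[/eqP -> //|jk]; split=> [i ij|].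
  by apply: ww'; exact: ltn_trans jk.
by rewrite ww'.
Qed.

Lemma agreeC k w w' : agree k w w' -> agree k w' w.
Proof. by move=> [ww' wk]; split=> // i ik; rewrite ww'. Qed.

Lemma agree_history k w w' : agree k w w' -> history_of w k = history_of w' k.
Proof.
move=> [ww' wk]; rewrite /history_of wk; congr pair.
by apply: eq_from_tnth => i; rewrite !tnth_mktuple ww'.
Qed.

(** A stopping rule reads whole plays, but its decision at a stage depends only on
    the history; any continuation of the history serves to read off the decision,
    here the constant one. *)
Definition extend (h : node) : play R N :=
  fun i => nth (h.2, (h.2, h.2)) h.1 i.

Lemma agree_branch aI aII h c k :
  agree (size h.1 + k) (extend (branch aI aII h c k)) (branch_play aI aII h c).
Proof.
set m := (size h.1 + k)%N; split=> [i im|].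
  rewrite /branch_play /extend.
  case: (leqP i.+1 k) => [ik|ki].
    by apply: nth_branch => //; rewrite addnS ltnS leq_addl.
  by apply/esym; apply: nth_branch => //; exact: ltnW.
have sz : size (branch aI aII h c k).1 = m by rewrite size_branch.
rewrite {1}/extend nth_default ?sz//=.
rewrite /branch_play (@nth_branch _ _ (h.2, (h.2, h.2)) (h.2, (h.2, h.2))
  h c k.+1 m.+1) ?addnS// ?ltnS ?leq_addl//=.
by rewrite nth_rcons sz ltnn eqxx.
Qed.

Lemma stop_time_agree (tau : stopping_rule R N) k w w' : agree k w w' ->
  (tau w <= k)%N = (tau w' <= k)%N.
Proof.
suff H v v' : agree k v v' -> (tau v <= k)%N -> (tau v' <= k)%N.
  by move=> ww'; apply/idP/idP; apply: H => //; exact: agreeC.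
move=> vv' vk; have [A _ HA] := stop_time_adapted tau (tau v).
have /HA -> // : A (history_of v' (tau v)).
by rewrite -(agree_history (agreeS vv' vk)); apply/HA.
Qed.

(** The inequality, in place of equality, is what passes to the continuation of a
    game, whose stopping time is a truncated difference (see [shift_time]).  On
    the nodes that a game reaches the two are equivalent. *)
Definition rule_stops (tau : stopping_rule R N) (h : node) : Prop :=
  (tau (extend h) <= size h.1)%N.

Definition stopped (Gamma : set 'rV[R]_N) (tau : stopping_rule R N) (h : node) :
  Prop := Gamma h.2 \/ rule_stops tau h.

(** Below a node without value there is always a child without value; following
    these children gives an infinite play on which the rule never stops. *)
Lemma value_exists P Gamma (tau : stopping_rule R N) aI aII h :
  exists v, value P (stopped Gamma tau) aI aII h v.
Proof.
set val := value P _ aI aII.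
pose b g := `[< ~ exists v, val (child aI aII g true) v >].
pose g k := iter k (fun h' => child aI aII h' (b h')) h.
pose c k := b (g k).
have gE k : g k = branch aI aII h c k by elim: k => //= k <-.
apply: contrapT => nv.
have nvg k : ~ exists v, val (g k) v.
  elim: k => //= k IH; case E : (b (g k)); first by move/asboolP: E.
  move=> [v2 V2]; apply: IH.
  have [S|nS] := pselect (stopped Gamma tau (g k)).
    by exists (P (g k).2); exact: value_stop.
  move/asboolP/contrapT: E => [v1 V1].
  by exists ((v1 + v2) / 2); exact: value_step.
pose w := branch_play aI aII h c.
apply: (nvg (tau w)); exists (P (g (tau w)).2); apply: value_stop; right.
rewrite /rule_stops gE size_branch (stop_time_agree tau (agree_branch _ _ _ _ _)).
exact: leq_addl.
Qed.

Definition act {eps} (S : strategy N eps) (h : node) : point R N :=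
  S (size h.1) (in_tuple h.1, h.2).

Lemma actE eps (S : strategy N eps) k (h : history R N k) :
  S k h = act S (tval h.1, h.2).
Proof.
case: h => -[t tk] p; rewrite /act /=.
have E := eqP tk; subst k; congr (S _ (_, _)); exact: val_inj.
Qed.

Lemma run_branch eps (SI SII : strategy N eps) x c :
  run SI SII x c = branch_play (act SI) (act SII) (start x) c.
Proof.
apply/funext => k; rewrite branch_play_start /run.
suff E : forall j, (tval (run_history SI SII x c j).1, (run_history SI SII x c j).2) =
    branch (act SI) (act SII) (start x) c j.
  by rewrite !actE -E.
elim=> //= j; move: (run_history SI SII x c j) => h <- /=.
by rewrite !actE; case: (c j).
Qed.

End GameTree.

(** * The expected payoff as a value of the tree *)

Section Expectation.
Context {R : realType} {N : nat}.
Context (Omega : set 'rV[R]_N) (gamma : R) (F Psi : 'rV[R]_N -> R) (eps : R).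
Context (tau : stopping_rule R N) (SI SII : strategy N eps) (x : 'rV[R]_N).

Let Gamma := boundary_strip Omega gamma.
Let pay := payoff Omega gamma F Psi.
Let stop := @stopped R N Gamma tau.
Let W := branch (act SI) (act SII) (start x).

Lemma run_agree_branch c k : agree k (extend (W c k)) (run SI SII x c).
Proof. by rewrite run_branch; exact: (agree_branch _ _ (start x)). Qed.

Lemma rule_stops_branch c k : rule_stops tau (W c k) = (tau (run SI SII x c) <= k)%N.
Proof.
by rewrite /rule_stops size_branch add0n (stop_time_agree tau (run_agree_branch c k)).
Qed.

Lemma terminal_position_branch c k :
  (forall i, (i < k)%N -> ~ stop (W c i)) -> stop (W c k) ->
  terminal_position Omega gamma tau (run SI SII x c) = (W c k).2.
Proof.
move=> nstop stopk; set w := run SI SII x c.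
have posE i : (w i).1 = (W c i).2 by rewrite /w run_branch branch_play_start.
have nG i : (i < k)%N -> ~ Gamma (w i).1.
  by move=> ik Gi; apply: (nstop _ ik); left; rewrite -posE.
have ktau : (k <= tau w)%N.
  rewrite leqNgt; apply/negP => tk; apply: (nstop _ tk); right.
  by rewrite rule_stops_branch.
suff E : terminal_stage Omega gamma tau w = k.
  by rewrite /terminal_position E posE.
rewrite /terminal_stage -(subnKC ktau) iotaD find_cat add0n.
have -> : has (fun i => ((w i).1 : 'rV[R]_N) \in boundary_strip Omega gamma)
    (iota 0 k) = false.
  apply/hasPn => i; rewrite mem_iota => /= ik.
  by apply/negP => /set_mem; exact: nG.
rewrite size_iota; case E : (tau w - k)%N => [|m]; first by rewrite addn0.
have Gk : ((w k).1 : 'rV[R]_N) \in boundary_strip Omega gamma.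
  apply/mem_set; rewrite posE; case: stopk => //.
  by rewrite rule_stops_branch -/w -subn_eq0 E.
by rewrite /= Gk addn0.
Qed.

Definition cylinder (b : nat -> bool) (k : nat) : set (measurableTypeR R) :=
  [set omega | forall i, (i < k)%N -> coin omega i = b i].

Definition force (b : nat -> bool) (k : nat) (t : bool) : nat -> bool :=
  fun i => if i == k then t else b i.

Lemma cylinderU b k :
  cylinder b k = cylinder (force b k true) k.+1 `|` cylinder (force b k false) k.+1.
Proof.
apply/seteqP; split=> omega.
  move=> H; suff : cylinder (force b k (coin omega k)) k.+1 omega.
    by case: (coin omega k); [left|right].
  move=> i; rewrite /force; case: eqP => [->//|/eqP ik].
  by rewrite ltnS leq_eqVlt (negbTE ik) /=; exact: H.
by case=> H i ik; have := H i (ltnW ik); rewrite /force ltn_eqF.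
Qed.

Let f (omega : measurableTypeR R) : \bar R :=
  (pay (terminal_position Omega gamma tau (run SI SII x (coin omega))))%:E.

(** The tosses b_0 .. b_(k-1) have probability 2^-k, and splitting a cylinder by
    its next toss turns the average in [value] into a sum of integrals.  At a
    stopped node the payoff is constant on the cylinder; this is why the
    integrand is measurable for arbitrary payoff functions. *)
Lemma integral_cylinder h v : value pay stop (act SI) (act SII) h v ->
  forall k b, h = W b k -> (forall i, (i < k)%N -> ~ stop (W b i)) ->
  measurable_fun (cylinder b k) f /\
  (\int[coin_prob R]_(omega in cylinder b k) f omega = (v * 2^-1 ^+ k)%:E)%E.
Proof.
elim=> {h v} [h stoph k b hE nstop|h v1 v2 nstoph _ IH1 _ IH2 k b hE nstop].
  have fE : {in cylinder b k, f =1 cst (pay h.2)%:E}.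
    move=> omega /set_mem Co; rewrite /f.
    have WE i : (i <= k)%N -> W (coin omega) i = W b i.
      by move=> ik; apply: eq_branch => j ji; apply: Co; exact: leq_trans ik.
    rewrite (@terminal_position_branch _ k) => [|i ik|]; first by rewrite WE// hE.
      by rewrite WE 1?ltnW//; exact: nstop.
    by rewrite WE// -hE.
  have mC : measurable (cylinder b k) by exact: measurable_coins.
  split.
    apply: (eq_measurable_fun (cst (pay h.2)%:E)) => [omega Co|].
      by rewrite fE.
    exact: measurable_cst.
  rewrite (eq_integral (cst (pay h.2)%:E)) => [|omega Co]; last by rewrite fE.
  rewrite integral_cst//= [X in (_ * X)%E](_ : _ = (2^-1 ^+ k)%:E) ?EFinM//.
  exact: coin_fair.
have forceE t i : (i <= k)%N -> W (force b k t) i = W b i.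
  move=> ik; apply: eq_branch => j ji.
  by rewrite /force ltn_eqF// (leq_trans ji).
have nstop' t i : (i < k.+1)%N -> ~ stop (W (force b k t) i).
  rewrite ltnS => ik; rewrite forceE//; move: ik; rewrite leq_eqVlt.
  by move=> /orP[/eqP ->|]; [rewrite -hE|exact: nstop].
have childE t : child (act SI) (act SII) h t = W (force b k t) k.+1.
  by rewrite /W /= -/(W _ _) forceE// -hE /force eqxx.
have [m1 I1] := IH1 _ _ (childE true) (nstop' true).
have [m2 I2] := IH2 _ _ (childE false) (nstop' false).
have mC t : measurable (cylinder (force b k t) k.+1) by exact: measurable_coins.
have mf : measurable_fun (cylinder b k) f.
  by rewrite cylinderU; apply/measurable_funU.
split=> //; rewrite cylinderU integral_setU//.
- by rewrite I1 I2 -EFinD exprS; congr EFin; field.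
- by rewrite -cylinderU.
- apply/disj_setPS => omega [H1 H2].
  by have := H1 k (ltnSn k); rewrite (H2 k (ltnSn k)) /force eqxx.
Qed.

Lemma expected_payoff_value v : value pay stop (act SI) (act SII) (start x) v ->
  expected_payoff Omega gamma F Psi x tau SI SII = v%:E.
Proof.
move=> V; have [//|_] := @integral_cylinder _ _ V 0%N xpredT erefl.
rewrite expr0 mulr1 => <-; rewrite /expected_payoff unlock.
by congr (integral _ _ _); apply/seteqP; split.
Qed.

Lemma terminates_always : terminates_as Omega gamma x tau SI SII.
Proof. by apply: aeW => omega; exists (tau (run SI SII x (coin omega))); right. Qed.

Lemma V_I_expected :
  V_I Omega gamma F Psi x tau SI SII = expected_payoff Omega gamma F Psi x tau SI SII.
Proof. by rewrite /V_I asboolT//; exact: terminates_always. Qed.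

Lemma V_II_expected :
  V_II Omega gamma F Psi x tau SI SII = expected_payoff Omega gamma F Psi x tau SI SII.
Proof. by rewrite /V_II asboolT//; exact: terminates_always. Qed.

End Expectation.

(** * Measurability on histories *)

Section MeasurableGeneralities.
Context {R : realType} {N : nat}.

Lemma measurable_piecewise d1 d2 (T1 : measurableType d1) (T2 : measurableType d2)
    (idx : T1 -> nat) (F : nat -> T1 -> T2) :
  measurable_fun setT idx -> (forall i, measurable_fun setT (F i)) ->
  measurable_fun setT (fun t => F (idx t) t).
Proof.
move=> midx mF _ Y mY; rewrite setTI.
have -> : (fun t => F (idx t) t) @^-1` Y =
    \bigcup_i ((idx @^-1` [set i]) `&` (F i @^-1` Y)).
  by apply/seteqP; split=> [t Yt|t [i _ [/= <-]]]; first by exists (idx t).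
apply: bigcupT_measurable => i; apply: measurableI.
  by rewrite -[X in measurable X]setTI; exact: midx.
by rewrite -[X in measurable X]setTI; exact: mF.
Qed.

Lemma measurable_fun_nat d1 (T1 : measurableType d1) (f : T1 -> nat) :
  (forall i, measurable (f @^-1` [set i])) -> measurable_fun setT f.
Proof.
move=> mf _ Y _; rewrite setTI.
have -> : f @^-1` Y = \bigcup_(i in Y) (f @^-1` [set i]).
  apply/seteqP; split=> [t Yt|t [i Yi /= fi]]; first by exists (f t).
  by rewrite /= fi.
exact: bigcup_measurable.
Qed.

Lemma measurable_open (A : set 'rV[R]_N) : open A -> measurable (A : set (point R N)).
Proof. by move=> oA; apply: sub_sigma_algebra. Qed.

Lemma measurable_singleton (y : 'rV[R]_N) : measurable ([set y] : set (point R N)).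
Proof.
rewrite -[X in measurable X]setCK; apply: measurableC; apply: measurable_open.
apply: closed_openC; apply: accessible_closed_set1; apply: hausdorff_accessible.
exact: norm_hausdorff.
Qed.

Lemma measurable_continuous (f : 'rV[R]_N -> 'rV[R]_N) : continuous f ->
  measurable_fun setT (f : point R N -> point R N).
Proof.
move=> cf; apply: (@measurability _ _ (point R N) (point R N) setT f (@open_sets R N)) => //.
move=> _ [A oA <-]; rewrite setTI; apply: measurable_open.
by apply: open_comp => // z _; exact: cf.
Qed.

Lemma continuous_homothety (V : normedModType R) (y : V) (c : R) :
  continuous (fun z : V => y + c *: (z - y)).
Proof.
move=> z; apply: cvgD; first exact: cvg_cst.
by apply: cvgZl_tmp; apply: cvgB; [exact: cvg_id|exact: cvg_cst].
Qed.

(** Countably many homotheties, glued along the annuli around y. *)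
Lemma measurable_pull (eps : R) (y : 'rV[R]_N) : 0 < eps ->
  measurable_fun setT (pull eps y : point R N -> point R N).
Proof.
move=> e0; apply: (@measurable_piecewise _ _ (point R N) (point R N)
  (annulus eps y) (fun m z => scale_to y m z)) => [|m]; last first.
  by apply: measurable_continuous; exact: (@continuous_homothety 'rV[R]_N).
apply: measurable_fun_nat => m.
have -> : annulus eps y @^-1` [set m] =
    [set z | enorm (z - y) < eps * m.+1%:R] `\`
    [set z | enorm (z - y) < eps * m%:R].
  apply/seteqP; split=> [z /= <-|z /= [lt1 lt2]].
    split; first exact: lt_annulusS.
    case E : (annulus eps y z) => [|i]; first by rewrite mulr0 ltNge enorm_ge0.
    by rewrite -annulus_le// E ltnn.
  apply/eqP; rewrite eqn_leq annulus_le// lt1 /=.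
  case: m lt2 {lt1} => // m lt2; rewrite ltnNge annulus_le//.
  exact/negP.
by apply: measurableD; apply: measurable_open; exact: open_eball.
Qed.

End MeasurableGeneralities.

Section MeasurableHistories.
Context {R : realType} {N : nat}.

Definition measurable_coords d (T : measurableType d) (G : T -> play R N) :=
  forall i, measurable_fun setT (fun t => G t i).

Lemma measurable_history d (T : measurableType d) (G : T -> play R N) k :
  measurable_coords G -> measurable_fun setT (fun t => history_of (G t) k).
Proof.
move=> mG; apply: measurable_fun_pair; last exact: measurableT_comp (mG k).
apply/measurable_fun_tnthP => i.
rewrite [X in measurable_fun _ X](_ : _ = (fun t => G t i)); first exact: mG.
by apply/funext => t /=; rewrite tnth_mktuple.
Qed.

Lemma measurable_stop_time d (T : measurableType d) (G : T -> play R N)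
    (tau : stopping_rule R N) :
  measurable_coords G -> measurable_fun setT (fun t => tau (G t)).
Proof.
move=> mG; apply: measurable_fun_nat => k.
have [A mA HA] := stop_time_adapted tau k.
have -> : (fun t => tau (G t)) @^-1` [set k] =
    (fun t => history_of (G t) k) @^-1` A.
  by apply/seteqP; split=> t /= /HA.
by rewrite -[X in measurable X]setTI; exact: measurable_history.
Qed.

Definition as_node k (h : history R N k) : node := (tval h.1, h.2).

Lemma measurable_extend k :
  measurable_coords (fun h : history R N k => extend (as_node h)).
Proof.
move=> i; have [ik|ki] := ltnP i k.
  rewrite [X in measurable_fun _ X](_ : _ = (fun h => tnth h.1 (Ordinal ik))).
    exact: (measurableT_comp (measurable_tnth _)).
  by apply/funext => h; rewrite /extend /= (tnth_nth (h.2, (h.2, h.2))).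
rewrite [X in measurable_fun _ X](_ : _ = (fun h => (h.2, (h.2, h.2)))).
  apply: measurable_fun_pair; first exact: measurable_snd.
  by apply: measurable_fun_pair; exact: measurable_snd.
by apply/funext => h; rewrite /extend nth_default//= size_tuple.
Qed.

Lemma agree_extend (w : play R N) k :
  agree k w (extend (as_node (history_of w k))).
Proof.
split=> [i ik|]; rewrite /extend /=.
  by have /= -> := nth_mktuple (fun j : 'I_k => w j)
    ((w k).1, ((w k).1, (w k).1)) (Ordinal ik).
by rewrite nth_default// size_map size_enum_ord.
Qed.

Section BuildStoppingRule.
Context (t : play R N -> nat).
Hypothesis t_agree : forall k w w', agree k w w' -> (t w <= k)%N -> (t w' <= k)%N.
Hypothesis t_measurable :
  forall k, measurable_fun setT (fun h : history R N k => t (extend (as_node h))).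

Lemma t_agree_eq k w w' : agree k w w' -> t w = k -> t w' = k.
Proof.
move=> ww' wk; have w'k : (t w' <= k)%N by apply: (t_agree ww'); rewrite wk.
apply/eqP; rewrite eqn_leq w'k /= -wk.
by apply: (t_agree (agreeC (agreeS ww' w'k))).
Qed.

(** A time whose comparison with k is decided by the history at stage k is a
    stopping rule: its decision is read off on the extended history. *)
Lemma build_adapted k : exists2 A : set (history R N k),
  measurable A & forall w, t w = k <-> A (history_of w k).
Proof.
exists ((fun h : history R N k => t (extend (as_node h))) @^-1` [set k]).
  by rewrite -[X in measurable X]setTI; exact: t_measurable.
move=> w; split=> /= H.
  exact: (t_agree_eq (agree_extend w k)).
exact: (t_agree_eq (agreeC (agree_extend w k))).
Qed.

Definition build_stopping_rule : stopping_rule R N := StoppingRule build_adapted.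

End BuildStoppingRule.

End MeasurableHistories.

(** * Continuations, and pulling before playing *)

Section Continuation.
Context {R : realType} {N : nat}.
Implicit Types (g h : @node R N) (w : play R N).

Definition cat_node h g : node := (h.1 ++ g.1, g.2).

(** The play that begins with the stages of h and goes on as w. *)
Definition splice h w : play R N := fun i =>
  if (i < size h.1)%N then nth (h.2, (h.2, h.2)) h.1 i else w (i - size h.1)%N.

Lemma extend_cat h g : extend (cat_node h g) = splice h (extend g).
Proof.
apply/funext => i; rewrite /extend /splice /= nth_cat; case: ifP => // ih.
exact: set_nth_default.
Qed.

Lemma agree_splice h w w' k :
  agree k w w' -> agree (size h.1 + k) (splice h w) (splice h w').
Proof.
move=> [ww' wk]; split=> [i ik|]; last by rewrite /splice ltnNge leq_addr addKn.
rewrite /splice; case: ltnP => // hi; apply: ww'.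
by rewrite ltn_subLR.
Qed.

Section ShiftStrategy.
Context {eps : R} (S : strategy N eps) (h : @node R N).

Definition shift_action k (g : history R N k) : point R N :=
  act S (cat_node h (as_node g)).

Lemma shift_action_measurable k : measurable_fun setT (@shift_action k).
Proof.
rewrite [X in measurable_fun _ X](_ : _ = S (size h.1 + k)%N \o
    (fun g : history R N k => (cat_tuple (in_tuple h.1) g.1, g.2))); last first.
  by apply/funext => g; rewrite /= actE.
apply: (measurableT_comp (@action_measurable _ _ _ S _)).
apply: measurable_fun_pair; last exact: measurable_snd.
apply/measurable_fun_tnthP => i.
have [j iE|j iE] := split_ordP i; subst i.
  rewrite [X in measurable_fun _ X](_ : _ = cst (tnth (in_tuple h.1) j)).
    exact: measurable_cst.
  by apply/funext => g /=; rewrite tnth_lshift.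
rewrite [X in measurable_fun _ X](_ : _ = (fun g : history R N k => tnth g.1 j)).
  exact: (measurableT_comp (measurable_tnth _)).
by apply/funext => g /=; rewrite tnth_rshift.
Qed.

Lemma act_ball g : eball g.2 eps (act S g).
Proof. exact: (@action_ball _ _ _ S _ (in_tuple g.1, g.2)). Qed.

Definition shift_strategy : strategy N eps :=
  Strategy shift_action_measurable (fun k (g : history R N k) => act_ball (cat_node h (as_node g))).

End ShiftStrategy.

Section ShiftRule.
Context (tau : stopping_rule R N) (h : @node R N).

(** The rule tau in the game resumed at h.  The truncation covers the plays on
    which tau has stopped before h. *)
Definition shift_time w : nat := (tau (splice h w) - size h.1)%N.

Lemma shift_time_agree k w w' :
  agree k w w' -> (shift_time w <= k)%N -> (shift_time w' <= k)%N.
Proof.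
move=> ww'; rewrite /shift_time !leq_subLR.
by rewrite (stop_time_agree tau (agree_splice h ww')).
Qed.

Lemma shift_time_measurable k :
  measurable_fun setT (fun g : history R N k => shift_time (extend (as_node g))).
Proof.
rewrite /shift_time.
apply: (measurableT_comp (f := fun n : nat => (n - size h.1)%N)) => //.
apply: measurable_stop_time => i; rewrite /splice; case: (i < size h.1)%N.
  exact: measurable_cst.
exact: measurable_extend.
Qed.

Definition shift_rule : stopping_rule R N :=
  build_stopping_rule shift_time_agree shift_time_measurable.

Lemma rule_stops_shift g :
  rule_stops shift_rule g <-> rule_stops tau (cat_node h g).
Proof.
by rewrite /rule_stops /= /shift_time extend_cat leq_subLR size_cat.
Qed.

End ShiftRule.

End Continuation.

Section PullThenPlay.
Context {R : realType} {N : nat} (y : 'rV[R]_N).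
Implicit Types (g h : @node R N) (w : play R N).

(** The value n means that y is not among the first n positions. *)
Definition hit (n : nat) w : nat := find (fun i => (w i).1 == y) (iota 0 n).

Lemma hitP n w i : hit n w = i <->
  [/\ (i <= n)%N, forall j, (j < i)%N -> (w j).1 <> y & (i < n)%N -> (w i).1 = y].
Proof.
rewrite /hit; set p := fun j => (w j).1 == y; split=> [<-|[lin ny iy]].
  have := find_size p (iota 0 n); rewrite size_iota => fn; split=> // [j jf|fin].
    have := before_find 0%N jf; rewrite nth_iota ?add0n.
      by move/negbT/eqP.
    exact: leq_trans jf fn.
  have := @nth_find _ 0%N p (iota 0 n).
  by rewrite has_find size_iota nth_iota ?add0n// => /(_ fin)/eqP.
rewrite -(subnKC lin) iotaD find_cat add0n.
have -> : has p (iota 0 i) = false.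
  by apply/hasPn => j; rewrite mem_iota /= add0n => ji; apply/eqP; exact: ny.
rewrite size_iota; case E : (n - i)%N => [|m]; first by rewrite addn0.
by rewrite /= /p iy ?eqxx ?addn0// -subn_gt0 E.
Qed.

Lemma measurable_hit d (T : measurableType d) (G : T -> play R N) n :
  measurable_coords G -> measurable_fun setT (fun t => hit n (G t)).
Proof.
move=> mG; apply: measurable_fun_nat => i.
have mat j : measurable [set t | (G t j).1 = y].
  rewrite -[X in measurable X]setTI.
  exact: (measurableT_comp measurable_fst (mG j)) measurableT _ (measurable_singleton y).
have mbefore : measurable [set t | forall j, (j < i)%N -> (G t j).1 <> y].
  rewrite [X in measurable X](_ : _ = \bigcap_(j in [set j | (j < i)%N])
    (~` [set t | (G t j).1 = y])) //.
  by apply: bigcap_measurableType => j _; apply: measurableC.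
have [ni|lin] := ltnP n i.
  rewrite [X in measurable X](_ : _ = set0)//; apply/seteqP; split=> t //=.
  by move=> /hitP[]; rewrite leqNgt ni.
have [lt_in|] := ltnP i n.
  rewrite [X in measurable X](_ : _ = [set t | forall j, (j < i)%N -> (G t j).1 <> y]
    `&` [set t | (G t i).1 = y]); first exact: measurableI.
  by apply/seteqP; split=> t /= => [/hitP[_ ? /(_ lt_in)]|[? ?]]; [split|apply/hitP].
move=> ni; rewrite [X in measurable X](_ : _ =
  [set t | forall j, (j < i)%N -> (G t j).1 <> y])//.
apply/seteqP; split=> t /=; first by move/hitP => [].
by move=> ?; apply/hitP; split=> //; rewrite ltnNge ni.
Qed.

Section Strategy.
Context {eps : R} (eps_gt0 : 0 < eps) (S : strategy N eps).

(** Once y has been visited, S is shown the history since the first visit only,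
    as if the game had started there. *)
Definition pull_then h : point R N :=
  let i := hit (size h.1).+1 (extend h) in
  if (i <= size h.1)%N then act S (drop i h.1, h.2) else pull eps y h.2.

Lemma pull_then_ball h : eball h.2 eps (pull_then h).
Proof.
rewrite /pull_then; case: ifP => _; last exact: pull_dist.
exact: (act_ball S (drop _ _, h.2)).
Qed.

Lemma pull_then_measurable k :
  measurable_fun setT (fun h : history R N k => pull_then (as_node h)).
Proof.
pose F i (h : history R N k) : point R N :=
  if (i <= k)%N then act S (drop i h.1, h.2) else pull eps y h.2.
rewrite [X in measurable_fun _ X](_ : _ =
    (fun h : history R N k => F (hit k.+1 (extend (as_node h))) h)); last first.
  by apply/funext => h; rewrite /pull_then /F /= size_tuple.
apply: measurable_piecewise.
  by apply: measurable_hit; exact: measurable_extend.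
move=> i; rewrite /F; case: (leqP i k) => ik; last first.
  by apply: (measurableT_comp (measurable_pull y eps_gt0)); exact: measurable_snd.
rewrite [X in measurable_fun _ X](_ : _ = S (k - i)%N \o
    (fun h : history R N k => (drop_tuple i h.1, h.2))); last first.
  by apply/funext => h; rewrite /= actE.
apply: (measurableT_comp (@action_measurable _ _ _ S _)).
apply: measurable_fun_pair; last exact: measurable_snd.
apply/measurable_fun_tnthP => j.
have ijk : (i + j < k)%N by rewrite -ltn_subRL.
rewrite [X in measurable_fun _ X](_ : _ =
    (fun h : history R N k => tnth h.1 (Ordinal ijk))).
  exact: (measurableT_comp (measurable_tnth _)).
by apply/funext => h /=; rewrite !(tnth_nth (h.2, (h.2, h.2))) /= nth_drop.
Qed.

Definition pull_then_strategy : strategy N eps :=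
  Strategy pull_then_measurable (fun k (h : history R N k) => pull_then_ball (as_node h)).

Lemma act_pull_then h : act pull_then_strategy h = pull_then h.
Proof. by case: h. Qed.

End Strategy.

Section Rule.
Context (n : nat) (tau : stopping_rule R N).

Definition shift_play i w : play R N := fun j => w (i + j)%N.

(** The rule that goes with [pull_then]: pull for at most n stages, and play by tau
    from the first visit to y on.  Stage n is included in the search, so that a
    visit at the deadline still opens the second phase. *)
Definition deadline_time w : nat :=
  let i := hit n.+1 w in
  if (i <= n)%N then (i + tau (shift_play i w))%N else n.

Lemma deadline_time_agree k w w' :
  agree k w w' -> (deadline_time w <= k)%N -> (deadline_time w' <= k)%N.
Proof.
move=> ww'; rewrite /deadline_time; set i := hit n.+1 w.
have posE j : (j <= k)%N -> (w j).1 = (w' j).1 by move=> /(agreeS ww')[].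
have /hitP[lin ny iy] := erefl i; case: (leqP i n) => [li ik|ni nk].
  have lik : (i <= k)%N by apply: leq_trans ik; exact: leq_addr.
  have -> : hit n.+1 w' = i.
    apply/hitP; split=> // [j ji|_]; last by rewrite -posE// iy.
    by rewrite -posE; [exact: ny|exact: leq_trans (ltnW ji) lik].
  rewrite li -leq_subRL// -(@stop_time_agree _ _ tau _ (shift_play i w)) ?leq_subRL//.
  by split=> [j jk|]; rewrite /shift_play ?subnKC//; [apply ww'.1; lia|exact: ww'.2].
have iE : i = n.+1 by apply/eqP; rewrite eqn_leq lin.
have -> : hit n.+1 w' = n.+1.
  apply/hitP; split=> // [j jn|]; last by rewrite ltnn.
  by rewrite -posE; [apply: ny; rewrite iE|exact: leq_trans nk].
by rewrite ltnn.
Qed.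

Lemma deadline_time_measurable k :
  measurable_fun setT (fun h : history R N k => deadline_time (extend (as_node h))).
Proof.
pose G (h : history R N k) := extend (as_node h).
have mG : measurable_coords G by exact: measurable_extend.
pose F i (h : history R N k) : nat := if (i <= n)%N then (i + tau (shift_play i (G h)))%N else n.
rewrite [X in measurable_fun _ X](_ : _ = (fun h : history R N k => F (hit n.+1 (G h)) h))//.
apply: measurable_piecewise.
  exact: measurable_hit.
move=> i; rewrite /F; case: (i <= n)%N; last exact: measurable_cst.
apply: (measurableT_comp (f := addn i)) => //.
by apply: measurable_stop_time => j; exact: mG.
Qed.

Definition deadline_rule : stopping_rule R N :=
  build_stopping_rule deadline_time_agree deadline_time_measurable.

End Rule.

Definition unhit (s : seq (stage R N)) : bool :=
  all (fun st : stage R N => (st.1 : 'rV[R]_N) != y) s.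

Lemma unhit_extend h w j : unhit h.1 -> (j < size h.1)%N -> (splice h w j).1 <> y.
Proof.
move=> /all_nthP H js; rewrite /splice js.
exact/eqP/(H (h.2, (h.2, h.2)) j js).
Qed.

Lemma hit_cat h w n : unhit h.1 -> (size h.1 < n)%N -> (w 0%N).1 = y ->
  hit n (splice h w) = size h.1.
Proof.
move=> uh hn wy; apply/hitP; split=> [|j jh|_]; first exact: ltnW.
  exact: unhit_extend.
by rewrite /splice ltnn subnn.
Qed.

Lemma hit_none h n : unhit h.1 -> h.2 <> y -> hit n (extend h) = n.
Proof.
move=> uh hy; apply/hitP; split=> // [j jn|]; last by rewrite ltnn.
rewrite /extend; case: (ltnP j (size h.1)) => jh; last by rewrite nth_default.
by have := unhit_extend (w := extend h) uh jh; rewrite /splice jh.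
Qed.

Lemma shift_splice h w : shift_play (size h.1) (splice h w) = w.
Proof.
by apply/funext => j; rewrite /shift_play /splice ltnNge leq_addr addKn.
Qed.

Section AfterHit.
Context {eps : R} (eps_gt0 : 0 < eps) (S : strategy N eps).
Context (n : nat) (tau : stopping_rule R N).

Lemma act_before_hit h : unhit h.1 -> h.2 <> y ->
  act (pull_then_strategy eps_gt0 S) h = pull eps y h.2.
Proof. by move=> uh hy; rewrite act_pull_then /pull_then hit_none// ltnn. Qed.

(** From the first visit to y on, the strategy is S itself; with
    [rule_after_hit], the resumed game is the one started at y. *)
Lemma act_after_hit h g : unhit h.1 -> (extend g 0).1 = y ->
  act (pull_then_strategy eps_gt0 S) (cat_node h g) = act S g.
Proof.
move=> uh gy; rewrite act_pull_then /pull_then extend_cat size_cat.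
rewrite hit_cat//; last by rewrite ltnS leq_addr.
by rewrite leq_addr drop_size_cat//; case: g gy.
Qed.

Lemma rule_before_hit h : unhit h.1 -> h.2 <> y ->
  rule_stops (deadline_rule n tau) h <-> (n <= size h.1)%N.
Proof.
by move=> uh hy; rewrite /rule_stops /= /deadline_time hit_none// ltnn.
Qed.

Lemma rule_after_hit h g : unhit h.1 -> (size h.1 <= n)%N -> (extend g 0).1 = y ->
  rule_stops (deadline_rule n tau) (cat_node h g) <-> rule_stops tau g.
Proof.
move=> uh hn gy; rewrite /rule_stops /= /deadline_time extend_cat hit_cat//.
by rewrite hn shift_splice size_cat leq_add2l.
Qed.

End AfterHit.

End PullThenPlay.

(** * Comparison with cones *)

Section ValueTheory.
Context {R : realType} {N : nat} (P : 'rV[R]_N -> R).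
Context (stop : @node R N -> Prop) (aI aII : @node R N -> point R N).
Implicit Types (g h : @node R N).

Let val := value P stop aI aII.

Section Bounds.
Context (I Hit : @node R N -> Prop) (U : @node R N -> R).

(** Optional stopping: U is a supermartingale until a node satisfies Hit, and
    there the value is bounded by other means.  I is an invariant of the reached
    nodes. *)
Lemma value_le :
  (forall h v, I h -> Hit h -> val h v -> v <= U h) ->
  (forall h, I h -> ~ Hit h -> stop h -> P h.2 <= U h) ->
  (forall h, I h -> ~ Hit h -> ~ stop h ->
     [/\ I (child aI aII h true), I (child aI aII h false) &
         U (child aI aII h true) + U (child aI aII h false) <= 2 * U h]) ->
  forall h v, I h -> val h v -> v <= U h.
Proof.
move=> Uhit Ustop Ustep h v + V; elim: V => {h v} [h stoph|h v1 v2 nstop V1 IH1 V2 IH2] Ih.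
  have [Hh|Hh] := pselect (Hit h); last exact: Ustop.
  by apply: Uhit => //; exact: value_stop.
have [Hh|Hh] := pselect (Hit h).
  by apply: Uhit => //; exact: value_step.
have [I1 I2 U12] := Ustep h Ih Hh nstop.
have := IH1 I1; have := IH2 I2; lra.
Qed.

Lemma value_ge :
  (forall h v, I h -> Hit h -> val h v -> U h <= v) ->
  (forall h, I h -> ~ Hit h -> stop h -> U h <= P h.2) ->
  (forall h, I h -> ~ Hit h -> ~ stop h ->
     [/\ I (child aI aII h true), I (child aI aII h false) &
         2 * U h <= U (child aI aII h true) + U (child aI aII h false)]) ->
  forall h v, I h -> val h v -> U h <= v.
Proof.
move=> Uhit Ustop Ustep h v + V; elim: V => {h v} [h stoph|h v1 v2 nstop V1 IH1 V2 IH2] Ih.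
  have [Hh|Hh] := pselect (Hit h); last exact: Ustop.
  by apply: Uhit => //; exact: value_stop.
have [Hh|Hh] := pselect (Hit h).
  by apply: Uhit => //; exact: value_step.
have [I1 I2 U12] := Ustep h Ih Hh nstop.
have := IH1 I1; have := IH2 I2; lra.
Qed.

End Bounds.

(** The game resumed at h is the game started at its position y, if strategies
    and rule are replaced by their restrictions to the histories through h.
    Agreement is required only on histories that begin at y, because [pull_then]
    recognizes its second phase by the presence of y. *)
Lemma value_continuation (stop' : @node R N -> Prop)
    (aI' aII' : @node R N -> point R N) (y : 'rV[R]_N) h v :
  (forall g, (extend g 0).1 = y ->
     [/\ stop (cat_node h g) <-> stop' g, aI (cat_node h g) = aI' g &
         aII (cat_node h g) = aII' g]) ->
  h.2 = y -> val h v -> value P stop' aI' aII' (start y) v.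
Proof.
move=> H hy V.
suff K : forall g v, (extend g 0).1 = y -> val (cat_node h g) v ->
    value P stop' aI' aII' g v.
  by apply: K => //; rewrite /cat_node cats0 -hy; case: (h) V.
move=> {hy} g {V}v + V; move E : (cat_node h g) V => k V.
elim: V g E => {k v} [k stopk|k v1 v2 nstop _ IH1 _ IH2] g E gy; subst k.
  by have [/proj1/(_ stopk) st _ _] := H g gy; exact: (value_stop _ _ _ st).
have [stopE aIE aIIE] := H g gy.
have childE b : cat_node h (child aI' aII' g b) = child aI aII (cat_node h g) b.
  by rewrite /child aIE aIIE /cat_node /= rcons_cat.
have child0 b : (extend (child aI' aII' g b) 0).1 = y.
  by rewrite -gy; case: (g) => -[|st s] p.
apply: value_step; first by move/stopE.
  by apply: IH1.
by apply: IH2.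
Qed.

End ValueTheory.

Lemma unhit_child {R : realType} {N : nat} (y : 'rV[R]_N) aI aII h b :
  unhit y h.1 -> h.2 <> y -> unhit y (child aI aII h b).1.
Proof.
by move=> uh /eqP hy; rewrite /unhit all_rcons -/(unhit y h.1) uh andbT.
Qed.

Section Strip.
Context {R : realType} {N : nat} (Omega : set 'rV[R]_N) (gamma : R).
Hypothesis Omega_open : open Omega.
Let Gamma := boundary_strip Omega gamma.

(** As eps <= gamma, the token cannot jump over the strip. *)
Lemma strip_move (eps : R) z z' : eps <= gamma -> Omega z -> enorm (z' - z) < eps ->
  Omega z' \/ Gamma z'.
Proof.
move=> eg Oz zz'; have [Oz'|nOz'] := pselect (Omega z'); [by left|right].
have [w bw z'w] := edist_to_boundary_le Omega_open Oz nOz'.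
split=> //; apply: le_trans (edist_to_le z' bw) _.
by apply: le_trans z'w _; apply: le_trans eg; exact: ltW.
Qed.

Lemma strip_nonempty : (0 < N)%N -> 0 < gamma -> Omega !=set0 ->
  bounded_set Omega -> exists p, Gamma p.
Proof.
move=> N0 g0 [z Oz] /bounded_enorm[M OM].
pose e : 'rV[R]_N := const_mx (`|M| + 1).
have nOe : ~ Omega e.
  move=> /OM; apply/negP; rewrite -ltNge.
  apply: (@lt_le_trans _ _ (`|M| + 1)); first by rewrite ltr_pwDr// ler_norm.
  have M1 : 0 <= `|M| + 1 by rewrite addr_ge0.
  rewrite -[leLHS](ger0_norm M1) -sqrtr_sqr ler_wsqrtr//.
  rewrite (bigD1 (Ordinal N0))//= mxE lerDl.
  by apply: sumr_ge0 => i _; exact: sqr_ge0.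
have [w bw _] := edist_to_boundary_le Omega_open Oz nOe.
exists w; split; first by move=> Ow; case: bw => _; rewrite ((interior_id Omega).1 Omega_open).
by rewrite (le_trans (edist_to_le w bw))// subrr enorm0 ltW.
Qed.

End Strip.

Section Cones.
Context {R : realType} {N : nat}.
Context (Omega : set 'rV[R]_N) (gamma : R) (F Psi : 'rV[R]_N -> R) (eps : R).
Hypothesis eps_gt0 : 0 < eps.
Context (L : R) (L_ge0 : 0 <= L).

Let Gamma := boundary_strip Omega gamma.
Let pay := payoff Omega gamma F Psi.
Let E x tau SI SII := @expected_payoff R N Omega gamma F Psi eps x tau SI SII.
Let uI := u_I Omega gamma F Psi eps.
Let uII := u_II Omega gamma F Psi eps.

Definition cone (y x : 'rV[R]_N) : R := L * (eps * (steps eps y x)%:R).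

Lemma cone_ge0 y x : 0 <= cone y x.
Proof. by rewrite mulr_ge0// mulr_ge0// ltW. Qed.

Lemma uI_ge (b : R) x tau SI : (forall SII, b%:E <= E x tau SI SII)%E -> (b%:E <= uI x)%E.
Proof.
move=> H; apply: le_ereal_sup_tmp; eexists; first by exists tau => //; exists SI.
by apply/ereal_infP => _ [SII _ <-]; rewrite V_I_expected.
Qed.

Lemma uII_le (b : R) x SII : (forall tau SI, E x tau SI SII <= b%:E)%E -> (uII x <= b%:E)%E.
Proof.
move=> H; apply: ge_ereal_inf; eexists; first by exists SII.
by apply/ereal_supP => _ [tau _ [SI _ <-]]; rewrite V_II_expected; exact: H.
Qed.

Lemma uI_gt (b : R) x : (b%:E < uI x)%E ->
  exists tau SI, forall SII, (b%:E <= E x tau SI SII)%E.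
Proof.
move=> /ereal_sup_gt[_ [tau _ [SI _ <-]] blt]; exists tau, SI => SII.
rewrite -[E _ _ _ _]V_I_expected (le_trans (ltW blt))//.
by apply: ereal_inf_lbound; exists SII.
Qed.

Lemma uII_lt (b : R) x : (uII x < b%:E)%E ->
  exists SII, forall tau SI, (E x tau SI SII <= b%:E)%E.
Proof.
move=> /ereal_inf_lt[_ [SII _ <-] blt]; exists SII => tau SI.
rewrite -[E _ _ _ _]V_II_expected (le_trans _ (ltW blt))//.
by apply: ereal_sup_ubound; exists tau => //; exists SI.
Qed.

Lemma uI_le_uII x : (uI x <= uII x)%E.
Proof.
apply/ereal_infP => _ [SII _ <-]; apply/ereal_supP => _ [tau _ [SI _ <-]].
apply: (@le_trans _ _ (E x tau SI SII)).
  by rewrite -[E _ _ _ _]V_I_expected; apply: ereal_inf_lbound; exists SII.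
rewrite -[E _ _ _ _]V_II_expected; apply: ereal_sup_ubound.
by exists tau => //; exists SI.
Qed.

Lemma expected_payoff_stop x tau SI SII : stopped Gamma tau (start x) ->
  E x tau SI SII = (pay x)%:E.
Proof. by move=> st; apply: expected_payoff_value; exact: value_stop. Qed.

(** Player II pulls to y and then plays a strategy that keeps the payoff below B;
    until then B + cone y is a supermartingale, which dominates the payoff
    wherever player I stops. *)
Lemma uII_le_pull_then y x (B : R) :
  (exists SII, forall tau SI, (E y tau SI SII <= B%:E)%E) ->
  (forall z, pay z <= B + cone y z) -> (uII x <= (B + cone y x)%:E)%E.
Proof.
move=> [S HS] payB; pose SII := pull_then_strategy y eps_gt0 S.
apply: (@uII_le _ _ SII) => tau SI.
have [v V] := value_exists pay Gamma tau (act SI) (act SII) (start x).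
rewrite /E (expected_payoff_value V) lee_fin.
apply: (value_le (I := fun h => unhit y h.1) (Hit := fun h => h.2 = y)
  (U := fun h => B + cone y h.2) _ _ _ _ V) => // [h w uh hy Vh|h uh hy nst].
  suff : value pay (stopped Gamma (shift_rule tau h)) (act (shift_strategy SI h))
      (act S) (start y) w.
    move=> /expected_payoff_value Ew; rewrite ler_wpDr ?cone_ge0// -lee_fin -Ew.
    exact: HS.
  apply: (value_continuation _ hy Vh) => g gy; split=> //.
    by split=> -[Gg|/rule_stops_shift ?]; [left|right|left|right].
  exact: act_after_hit.
have uch b : unhit y (child (act SI) (act SII) h b).1.
  exact: unhit_child.
have pullE : act SII h = pull eps y h.2 by exact: act_before_hit.
split; [exact: uch|exact: uch|].
have s1 : (steps eps y (act SI h))%:R <= (steps eps y h.2)%:R + 1 :> R.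
  by rewrite natr1 ler_nat; apply: steps_move => //; [exact/eqP|exact: act_ball].
have s2 : (steps eps y (act SII h))%:R + 1 <= (steps eps y h.2)%:R :> R.
  by rewrite natr1 ler_nat pullE; apply: steps_pull => //; exact/eqP.
rewrite /cone [(child _ _ _ true).2]/(act SI h) [(child _ _ _ false).2]/(act SII h).
move: s1 s2; move: (steps _ _ _)%:R (steps _ _ _)%:R (steps _ _ _)%:R => a b c s1 s2.
have : 0 <= L * eps * (2 * b - a - c) by rewrite mulr_ge0 ?mulr_ge0//; [exact: ltW|lra].
lra.
Qed.

Section LowerCone.
Hypothesis Omega_open : open Omega.
Hypothesis eps_gamma : eps <= gamma.

(** The dual argument has one more difficulty: player I has to commit to a finite
    stopping rule, and payoffs in Omega are only bounded below by B - K, so stopping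
    early is costly.  The probability of an early stop is controlled by adding to
    the cone a multiple of the strictly concave function g of the number of steps. *)
Lemma uI_ge_pull_then y x (B K : R) (J : nat) :
  (exists tau SI, forall SII, (B%:E <= E y tau SI SII)%E) ->
  (forall z, Gamma z -> B - cone y z <= pay z) ->
  0 <= K -> (forall z, Omega z -> B - K <= pay z) ->
  (forall z, Omega z -> (steps eps y z <= J)%N) ->
  (Omega `|` Gamma) x -> (steps eps y x <= J.+1)%N ->
  ((B - cone y x)%:E <= uI x)%E.
Proof.
move=> [tau0 [S HS]] payG K0 payO stepsO OGx stepsx.
(* g(t - 1) + g(t + 1) = 2 g(t) - 2, and g increases on [0, J + 1]: on average
   each stage lowers g by at least 1 before y is reached. *)
pose a : R := 2 * (J.+1)%:R.
pose g (t : R) := t * (a - t).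
have gmono s t : 0 <= s -> s <= t -> t <= J.+1%:R -> g s <= g t.
  move=> s0 st tJ; have : 0 <= (t - s) * (a - s - t) by rewrite mulr_ge0 /a//; lra.
  rewrite /g; nra.
have g_ge0 t : 0 <= t -> t <= J.+1%:R -> 0 <= g t.
  by move=> t0 tJ; rewrite mulr_ge0// /a; lra.
(* The error term g / n tends to 0 as the deadline n grows. *)
suff H n : (0 < n)%N ->
    ((B - cone y x - K / n%:R * g (steps eps y x)%:R)%:E <= uI x)%E.
  apply/lee_addgt0Pr => e e0.
  pose m := (Num.truncn (K * g (steps eps y x)%:R / e)).+1.
  apply: (@le_trans _ _ ((B - cone y x - K / m%:R * g (steps eps y x)%:R)%:E + e%:E)%E).
    rewrite -EFinD lee_fin -addrA lerDl addrC subr_ge0.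
    rewrite mulrAC ltW// ltr_pdivrMr ?ltr0n// (mulrC e) -ltr_pdivrMr//.
    exact: truncnS_gt.
  by rewrite leeD2r// H.
move=> n0; set kappa := K / n%:R.
have kappa0 : 0 <= kappa by rewrite divr_ge0.
pose tau := deadline_rule y n tau0; pose SI := pull_then_strategy y eps_gt0 S.
apply: (@uI_ge _ _ tau SI) => SII.
have [v V] := value_exists pay Gamma tau (act SI) (act SII) (start x).
rewrite /E (expected_payoff_value V) lee_fin.
pose I (h : node) := [/\ unhit y h.1, (size h.1 <= n)%N, (Omega `|` Gamma) h.2 &
  (steps eps y h.2 <= J.+1)%N].
(* g + stage number is a supermartingale; at the deadline n it is at least n, so
   kappa times it pays for the loss K. *)
pose U (h : node) := B - cone y h.2 -
  kappa * (g (steps eps y h.2)%:R + (size h.1)%:R).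
have UE : B - cone y x - kappa * g (steps eps y x)%:R = U (start x).
  by rewrite /U /= addr0.
rewrite UE.
apply: (value_ge (I := I) (Hit := fun h => h.2 = y) _ _ _ _ V) => //.
- move=> h w [uh hn _ _] hy Vh.
  suff : value pay (stopped Gamma tau0) (act S) (act (shift_strategy SII h))
      (start y) w.
    move=> /expected_payoff_value Ew; apply: (@le_trans _ _ B).
      rewrite /U hy /cone steps_id !mulr0 subr0 /g mul0r add0r lerBlDr lerDl.
      by rewrite mulr_ge0.
    by rewrite -lee_fin -Ew; exact: HS.
  apply: (value_continuation _ hy Vh) => k ky; split=> //.
    by split=> -[Gk|st]; [left|right|left|right];
      rewrite ?Gk//; apply/(rule_after_hit tau0 uh hn ky).
  exact: act_after_hit.
- move=> h [uh hn OGh hJ] hy st.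
  have gh : 0 <= g (steps eps y h.2)%:R by rewrite g_ge0// ler_nat.
  have [Gh|nGh] := pselect (Gamma h.2).
    apply: le_trans (payG _ Gh); rewrite /U lerBlDr lerDl mulr_ge0// addr_ge0//.
  case: OGh => // Oh; case: st => // /rule_before_hit => /(_ uh hy) nh.
  apply: le_trans (payO _ Oh); rewrite /U -addrA lerD2l -opprD lerN2.
  apply: (@le_trans _ _ (kappa * n%:R)); first by rewrite divfK// pnatr_eq0 -lt0n.
  rewrite ler_wpDl ?cone_ge0// ler_wpM2l//.
  by rewrite ler_wpDl// ler_nat.
- move=> h [uh hn OGh hJ] hy nst.
  have Oh : Omega h.2 by case: OGh => // Gh; case: nst; left.
  have hltn : (size h.1 < n)%N.
    by rewrite ltnNge; apply/negP => nh; apply: nst; right; apply/rule_before_hit.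
  have uch b : unhit y (child (act SI) (act SII) h b).1.
    exact: unhit_child.
  have sch b : size (child (act SI) (act SII) h b).1 = (size h.1).+1.
    by rewrite size_rcons.
  have /eqP hy' := hy.
  have jJ := stepsO _ Oh.
  have pullE : act SI h = pull eps y h.2 by exact: act_before_hit.
  have s1 : (steps eps y (act SII h) <= (steps eps y h.2).+1)%N.
    by apply: steps_move => //; exact: act_ball.
  have s2 : ((steps eps y (act SI h)).+1 <= steps eps y h.2)%N.
    by rewrite pullE; exact: steps_pull.
  have I1 : I (child (act SI) (act SII) h true).
    split; [exact: uch|by rewrite sch| |].
      exact: (strip_move Omega_open eps_gamma Oh (act_ball SI h)).
    by change (steps eps y (act SI h) <= J.+1)%N; lia.
  have I2 : I (child (act SI) (act SII) h false).
    split; [exact: uch|by rewrite sch| |].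
      exact: (strip_move Omega_open eps_gamma Oh (act_ball SII h)).
    by change (steps eps y (act SII h) <= J.+1)%N; lia.
  split=> //; rewrite /U !sch /cone [(child _ _ _ true).2]/(act SI h)
    [(child _ _ _ false).2]/(act SII h).
  have s1' : (steps eps y (act SII h))%:R <= (steps eps y h.2)%:R + 1 :> R.
    by rewrite natr1 ler_nat.
  have s2' : (steps eps y (act SI h))%:R + 1 <= (steps eps y h.2)%:R :> R.
    by rewrite natr1 ler_nat.
  have jJ' : (steps eps y h.2)%:R + 1 <= J.+1%:R :> R by rewrite natr1 ler_nat ltnS.
  have s0' : 0 <= (steps eps y (act SI h))%:R :> R by [].
  have s0'' : 0 <= (steps eps y (act SII h))%:R :> R by [].
  rewrite -[in (size h.1).+1%:R]natr1.
  move: s1' s2' jJ' s0' s0''.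
  move: (steps eps y h.2)%:R (steps eps y (act SI h))%:R (steps eps y (act SII h))%:R
    (size h.1)%:R => j j1 j2 s s1' s2' jJ' s0' s0''.
  have g1 : g j1 <= g (j - 1) by apply: gmono => //; lra.
  have g2 : g j2 <= g (j + 1) by apply: gmono => //; lra.
  have g3 : g (j - 1) + g (j + 1) = 2 * g j - 2 by rewrite /g; ring.
  have p1 : 0 <= L * eps * (2 * j - j1 - j2) by rewrite mulr_ge0 ?mulr_ge0//; [exact: ltW|lra].
  have p2 : 0 <= kappa * (2 * g j - 2 - g j1 - g j2) by rewrite mulr_ge0//; lra.
  move: p1 p2; move: (g j) (g j1) (g j2) => x0 x1 x2; lra.
Qed.

End LowerCone.
End Cones.

(** * Lipschitz continuity of the values *)

Section TrivialPlay.
Context {R : realType} {N : nat}.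

Lemma stay_ball (eps : R) : 0 < eps ->
  forall k (h : history R N k), eball h.2 eps h.2.
Proof. by move=> e0 k h; rewrite /eball /= subrr enorm0. Qed.

Definition stay_strategy (eps : R) (eps_gt0 : 0 < eps) : strategy N eps :=
  Strategy (fun k => measurable_snd) (stay_ball eps_gt0).

Definition stop_at_once : stopping_rule R N :=
  build_stopping_rule (t := fun=> 0%N) (fun _ _ _ _ le0 => le0)
    (fun k => measurable_cst 0%N).

End TrivialPlay.

Section Regularity.
Context {R : realType} {N : nat}.
Context (Omega : set 'rV[R]_N) (gamma : R) (F Psi : 'rV[R]_N -> R).
Let Gamma := boundary_strip Omega gamma.
Let pay := payoff Omega gamma F Psi.

(** As Psi <= F, the payoff may jump upwards on entering the strip; the upper
    Lipschitz bound survives except for x in the strip and y outside it. *)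
Lemma lipschitz_payoff :
  elipschitz Gamma F -> (forall x, Gamma x -> Psi x <= F x) -> elipschitz setT Psi ->
  exists2 L, 0 <= L &
    (forall x y, Gamma y -> pay x <= pay y + L * enorm (x - y)) /\
    (forall x y, ~ Gamma x -> pay x <= pay y + L * enorm (x - y)).
Proof.
move=> [LF HF] PsiF [LP HP]; exists (`|LF| + `|LP|); first by rewrite addr_ge0.
have payG x : Gamma x -> pay x = F x by move=> Gx; rewrite /pay /payoff mem_set.
have payP x : ~ Gamma x -> pay x = Psi x.
  by move=> Gx; rewrite /pay /payoff memNset.
have Psi_pay x : Psi x <= pay x.
  by have [Gx|nGx] := pselect (Gamma x); [rewrite payG//; exact: PsiF|rewrite payP].
have lF x y : Gamma x -> Gamma y -> F x <= F y + (`|LF| + `|LP|) * enorm (x - y).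
  move=> Gx Gy; rewrite -lerBlDl (le_trans (ler_norm _))// (le_trans (HF _ _ Gx Gy))//.
  rewrite ler_wpM2r ?enorm_ge0// (le_trans (ler_norm _))//.
  by rewrite lerDl.
have lP x y : Psi x <= Psi y + (`|LF| + `|LP|) * enorm (x - y).
  rewrite -lerBlDl (le_trans (ler_norm _))// (le_trans (HP _ _ I I))//.
  rewrite ler_wpM2r ?enorm_ge0// (le_trans (ler_norm _))//.
  by rewrite lerDr.
have out x y : ~ Gamma x -> pay x <= pay y + (`|LF| + `|LP|) * enorm (x - y).
  by move=> nGx; rewrite payP// (le_trans (lP x y))// lerD2r.
split=> // x y Gy; have [Gx|] := pselect (Gamma x); last exact: out.
by rewrite !payG//; exact: lF.
Qed.

End Regularity.

Section ValueLipschitz.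
Context {R : realType} {N : nat}.
Context (Omega : set 'rV[R]_N) (gamma : R) (F Psi : 'rV[R]_N -> R).
Context (eps : R) (L : R).
Let Gamma := boundary_strip Omega gamma.
Let pay := payoff Omega gamma F Psi.
Hypothesis Omega_open : open Omega.
Hypothesis Omega_bounded : bounded_set Omega.
Hypothesis Omega_nonempty : Omega !=set0.
Hypothesis Gamma_nonempty : exists p, Gamma p.
Hypothesis eps_gt0 : 0 < eps.
Hypothesis eps_gamma : eps <= gamma.
Hypothesis L_ge0 : 0 <= L.
Hypothesis pay_strip : forall x y, Gamma y -> pay x <= pay y + L * enorm (x - y).
Hypothesis pay_out : forall x y, ~ Gamma x -> pay x <= pay y + L * enorm (x - y).

Let uI := u_I Omega gamma F Psi eps.
Let uII := u_II Omega gamma F Psi eps.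
Let D := Omega `|` Gamma.
Let cn := @cone R N eps L.

Lemma cone_sym x y : cn x y = cn y x.
Proof. by rewrite /cn /cone /steps /annulus eq_sym enormB. Qed.

Lemma lip_le_cone x y : L * enorm (x - y) <= cn y x.
Proof. by rewrite /cn /cone ler_wpM2l//; exact: enorm_le_steps. Qed.

Lemma stop_at_once_stopped x : stopped Gamma (@stop_at_once R N) (start x).
Proof. by right; rewrite /rule_stops. Qed.

(** Omega is bounded, so the number of steps to y is bounded on Omega and the
    payoff is bounded below there, as [uI_ge_pull_then] requires. *)
Lemma uI_ge_cone y x (B : R) :
  (exists tau SI, forall SII : strategy N eps,
    (B%:E <= expected_payoff Omega gamma F Psi y tau SI SII)%E) ->
  (forall z, Gamma z -> B - cn y z <= pay z) -> D x ->
  ((B - cn y x)%:E <= uI x)%E.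
Proof.
move=> HB payG Dx; have [M OM] := bounded_enorm Omega_bounded.
have [p Op] := Omega_nonempty.
have OD w z : Omega z -> enorm (z - w) <= M + enorm w.
  move=> Oz; rewrite (le_trans (enorm_triangle 0 _ _))// subr0 sub0r enormN.
  by rewrite lerD2r OM.
pose K := Num.max 0 (B - pay p + L * (M + enorm p)).
pose J := maxn (Num.truncn ((M + enorm y) / eps)).+1 (steps eps y x).
apply: (uI_ge_pull_then eps_gt0 L_ge0 Omega_open eps_gamma (K := K) (J := J) HB) => //.
- by rewrite le_max lexx.
- move=> z Oz; apply: (@le_trans _ _ (pay p - L * (M + enorm p))).
    have : B - pay p + L * (M + enorm p) <= K by rewrite le_max lexx orbT.
    lra.
  have nGp : ~ Gamma p by case.
  rewrite lerBlDr (le_trans (pay_out z nGp))// lerD2l ler_wpM2l//.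
  by rewrite enormB OD.
- move=> z Oz; rewrite leq_max; apply/orP; left; rewrite /steps; case: ifP => // _.
  by rewrite ltnS le_truncn// ler_pM2r ?invr_gt0// OD.
- by rewrite leqW// leq_max leqnn orbT.
Qed.

(** At a point of the strip the game is over, whatever the strategies. *)
Lemma uI_ge_boundary y x : Gamma y -> D x -> ((pay y - cn y x)%:E <= uI x)%E.
Proof.
move=> Gy; apply: uI_ge_cone => [|z Gz].
  exists (@stop_at_once R N), (stay_strategy eps_gt0) => SII.
  by rewrite expected_payoff_stop; [exact: lexx|left].
rewrite lerBlDr (le_trans (pay_strip _ Gz))// lerD2l enormB; exact: lip_le_cone.
Qed.

Lemma uII_le_boundary y x : Gamma y -> (uII x <= (pay y + cn y x)%:E)%E.
Proof.
move=> Gy; apply: (uII_le_pull_then eps_gt0 L_ge0) => [|z].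
  exists (stay_strategy eps_gt0) => tau SI.
  by rewrite expected_payoff_stop; [exact: lexx|left].
by rewrite (le_trans (pay_strip _ Gy))// lerD2l; exact: lip_le_cone.
Qed.

Lemma pay_le_uI x : ((pay x)%:E <= uI x)%E.
Proof.
apply: (uI_ge (tau := @stop_at_once R N) (SI := stay_strategy eps_gt0)) => SII.
by rewrite expected_payoff_stop; [exact: lexx|exact: stop_at_once_stopped].
Qed.

Lemma uI_uII_fin x : uI x \is a fin_num /\ uII x \is a fin_num.
Proof.
have [p Gp] := Gamma_nonempty.
have l := pay_le_uI x; have u := uII_le_boundary x Gp.
have lu := uI_le_uII Omega gamma F Psi eps x.
split; rewrite fin_numE; apply/andP; split; apply/eqP => E.
- by move: l; rewrite E leeNy_eq.
- by move: (le_trans lu u); rewrite -/(uI x) E leye_eq.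
- by move: (le_trans l lu); rewrite -/(uII x) E leeNy_eq.
- by move: u; rewrite E leye_eq.
Qed.

(** The payoffs on the strip lie below the cone with vertex y by
    [uI_ge_boundary] with the roles of the two points exchanged, the others because
    Psi <= u_I. *)
Lemma uII_le_cone y x : D y -> (uII x <= uII y + (cn y x)%:E)%E.
Proof.
move=> Dy; have [_ /fineK] := uI_uII_fin y.
move: (fine _) => b bE; apply/lee_addgt0Pr => e e0.
rewrite -bE -!EFinD addrAC.
have luy : (uI y <= b%:E)%E by rewrite bE; exact: uI_le_uII.
apply: (uII_le_pull_then eps_gt0 L_ge0) => [|z].
  by apply: uII_lt; rewrite -/(uII y) -bE lte_fin ltrDl.
rewrite addrAC; apply: (@le_trans _ _ (b + cn y z)); last by rewrite lerDl ltW.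
have [Gz|nGz] := pselect (Gamma z).
  by rewrite -lerBlDr cone_sym -lee_fin (le_trans (uI_ge_boundary Gz Dy)).
rewrite (le_trans (pay_out y nGz))// lerD ?lip_le_cone//.
by rewrite -lee_fin (le_trans (pay_le_uI y)).
Qed.

(** Here only the payoffs on the strip matter, and they lie above the cone by
    [uII_le_boundary] with the roles of the two points exchanged. *)
Lemma uI_le_cone y x : D x -> (uI y <= uI x + (cn y x)%:E)%E.
Proof.
move=> Dx; have [/fineK + _] := uI_uII_fin y.
move: (fine _) => a aE; apply/lee_addgt0Pr => e e0.
rewrite -aE -addeA -EFinD -leeBlDr// -EFinB opprD addrA addrAC.
apply: uI_ge_cone => // [|z Gz].
  by apply: uI_gt; rewrite -/(uI y) -aE lte_fin gtrBl.
rewrite -addrA -opprD lerBlDr addrA.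
apply: (@le_trans _ _ (pay z + cn y z)); last by rewrite addrAC lerDl ltW.
rewrite -lee_fin aE cone_sym (le_trans _ (uII_le_boundary y Gz))//.
exact: uI_le_uII.
Qed.

Lemma lee_dist (u v : \bar R) (c : R) : u \is a fin_num -> v \is a fin_num ->
  (u <= v + c%:E)%E -> (v <= u + c%:E)%E -> (`|u - v| <= c%:E)%E.
Proof.
move=> /fineK <- /fineK <-; rewrite -EFinB -!EFinD abse_EFin !lee_fin => uv vu.
by rewrite ler_norml; apply/andP; split; lra.
Qed.

Lemma cone_le_d_eps y x : cn y x <= L * d_eps eps x y.
Proof. by rewrite ler_wpM2l//; exact: steps_le_d_eps. Qed.

Lemma values_lipschitz x y : D x -> D y ->
  (`|uI x - uI y| <= (L * d_eps eps x y)%:E)%E /\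
  (`|uII x - uII y| <= (L * d_eps eps x y)%:E)%E.
Proof.
move=> Dx Dy; have [fx gx] := uI_uII_fin x; have [fy gy] := uI_uII_fin y.
have le_d z : (z + (cn y x)%:E <= z + (L * d_eps eps x y)%:E)%E.
  by rewrite leeD2l// lee_fin cone_le_d_eps.
split; apply: lee_dist => //; apply: le_trans (le_d _).
- by rewrite cone_sym; exact: uI_le_cone.
- exact: uI_le_cone.
- exact: uII_le_cone.
- by rewrite cone_sym; exact: uII_le_cone.
Qed.

End ValueLipschitz.

Theorem lemma4 (R : realType) (N : nat) (Omega : set 'rV[R]_N) (gamma : R)
    (F Psi : 'rV[R]_N -> R) :
  (0 < N)%N ->
  bounded_smooth_domain Omega ->
  0 < gamma ->
  elipschitz (boundary_strip Omega gamma) F ->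
  (forall x, boundary_strip Omega gamma x -> Psi x <= F x) ->
  elipschitz setT Psi ->
  exists C : R, forall eps : R, 0 < eps <= gamma ->
    forall x y : 'rV[R]_N,
      (Omega `|` boundary_strip Omega gamma) x ->
      (Omega `|` boundary_strip Omega gamma) y ->
      (`| u_I Omega gamma F Psi eps x - u_I Omega gamma F Psi eps y |
         <= (C * d_eps eps x y)%:E)%E /\
      (`| u_II Omega gamma F Psi eps x - u_II Omega gamma F Psi eps y |
         <= (C * d_eps eps x y)%:E)%E.
Proof.
move=> N0 [Oo _ On Ob _] g0 lipF PsiF lipPsi.
have [L L0 [payG payO]] := lipschitz_payoff lipF PsiF lipPsi.
have Gn := strip_nonempty Oo N0 g0 On Ob.
exists L => eps /andP[e0 eg] x y Dx Dy.
exact: (values_lipschitz Oo Ob On Gn e0 eg L0 payG payO Dx Dy).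
Qed.
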